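(* Let $\phi$ be a Sturmian coloring of the $d$-regular tree $T$ and suppose that for some $n$ the graph $\mathcal G_n$ has a cycle. Let $m$ be the smallest integer such that $S_m\ne C_m$ and both $S_m$ and $C_m$ are in the cycle of $\mathcal G_m$. (1) The coloring $\phi$ is of bounded type. (2) Either all the graphs $\mathcal G^A_n$, $n\ge m$, are isomorphic (as edge-indexed graphs) and the quotient graph $X_\phi$ is isomorphic to $\varinjlim\mathcal G^B_n$, or all the graphs $\mathcal G^B_n$, $n\ge m$, are isomorphic and $X_\phi$ is isomorphic to $\varinjlim\mathcal G^A_n$. (3) By (1), $X_\phi$ is an infinite ray (with loops possibly attached); let $x_0,x_1,x_2,\dots$ be its vertices in order, starting from the end vertex $x_0$. Then the ball $\mathcal B_{m+i}(x_i)$ (the $(m+i)$-ball around any lift of $x_i$ to $T$) is special for all $i\ge0$.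
   Context: Balls and Sturmian colorings. $T$ is a $d$-regular tree with vertex set $VT$ and path metric. For $\phi:VT\to\{a,b\}$, $\mathcal B_n(x)$ is the closed $n$-ball around $x$, colored by $\phi$; two $n$-balls are equivalent if there is a color-preserving isomorphism of balls between them (center to center); $[\mathcal B_n(x)]$ is the class, $\mathbf B_n(\phi)$ the set of classes. $\phi$ is Sturmian if $|\mathbf B_n(\phi)|=n+2$ for all $n\ge0$. Then for each $n\ge0$ there is a unique class $S_n$ (special $n$-ball) which is the restriction to the concentric $n$-ball of two distinct classes $A_{n+1},B_{n+1}$ of $(n+1)$-balls; any other class $D$ of $n$-balls has a unique extension $\overline D$ to an $(n+1)$-ball class. A ball is special if its class is $S_n$. $C_n$ is the central $n$-ball of $S_{n+1}$. The type set of $v$ is $\{m\ge0:[\mathcal B_m(v)]=S_m\}$; $\phi$ is of bounded type if all type sets are finite. $X_\phi=G\backslash T$, where $G$ is the group of $\phi$-preserving automorphisms of $T$; it is colored by $\phi$ and edge-indexed: the index from $x$ to $y$ is the number of neighbors in the class $y$ of a lift of $x$. It is known that $X_\phi$ is an infinite ray (loops possibly attached) if $\phi$ is of bounded type. Naming: colors are named so that $S_0=A_0=[a]$, $B_0=[b]$. $D$ is always adjacent to $E$ if every ball of class $D$ has its center at distance 1 from the center of some ball of class $E$. Inductively $A_{n+1}$ is always adjacent to $A_n$, $B_{n+1}$ to $B_n$, and the center of $A_{n+1}$ has more neighbors with $n$-ball in class $A_n$ than that of $B_{n+1}$. Graphs. $\mathcal G_n$ has vertex set $\mathbf B_n(\phi)$,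 with an edge between $D,E$ if there are $x,y\in VT$ at distance 1 with $[\mathcal B_n(x)]=D,[\mathcal B_n(y)]=E$. A cycle has length $>1$ (loops are not cycles). For $X\neq S_n$, $i_A(X,Y)=i_B(X,Y)$ is the number of $n$-balls of class $Y$ centered at neighbors of the center of a ball of class $X$; $i_A(S_n,Y)$ (resp. $i_B(S_n,Y)$) is the number of those centered at neighbors of the center of $A_{n+1}$ (resp. $B_{n+1}$). $\mathcal G^A_n$ is the edge-indexed oriented graph on the classes reachable from $S_n$ by oriented edges of positive $i_A$, with the oriented edges (and loops) of positive $i_A$, indexed by $i_A$; $\mathcal G^B_n$ likewise with $i_B$. Direct limit. For $*\in\{A,B\}$ the extension map on $V\mathcal G^*_n$ sends $U\ne S_n$ to $\overline U$ and $S_n$ to $A_{n+1}$ if $*=A$, to $B_{n+1}$ if $*=B$. $\varinjlim\mathcal G^*_n$ has as vertex set the direct limit of the $V\mathcal G^*_n$ ($n\ge m$) along these maps, and as edge indices the eventual values of the indices. *)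

(* Defs.v *)
From HB Require Import structures.
From Stdlib Require Import Relation_Operators.
From mathcomp Require Import all_boot.
From mathcomp Require Import all_classical.

Set Implicit Arguments.
Unset Strict Implicit.
Unset Printing Implicit Defensive.

Local Open Scope classical_set_scope.

(** ** Regular trees *)

(* A locally finite simple graph is given by the lists of neighbors of its
   vertices; the order in these lists is irrelevant. *)
Record regular_tree (d : nat) := RegularTree {
  vertex :> choiceType;
  nbr : vertex -> seq vertex;
  nbr_uniq : forall x, uniq (nbr x);
  nbr_size : forall x, size (nbr x) = d;
  nbr_sym : forall x y, (y \in nbr x) = (x \in nbr y);
  nbr_irr : forall x, x \notin nbr x;
  tree_inhabited : exists x : vertex, True;
  tree_connected :
    forall x y, exists2 p, path (fun u v => v \in nbr u) x p & last x p = y;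
  tree_acyclic :
    forall c, uniq c -> cycle (fun u v => v \in nbr u) c -> size c <= 2
}.

Section Tree.
Variables (d : nat) (T : regular_tree d).

Definition adj : rel T := fun x y => y \in nbr x.

Definition cball (n : nat) (x : T) : set T :=
  [set y | exists p, [/\ path adj x p, last x p = y & size p <= n]].

Definition nb_count (x : T) (Y : set T) : nat :=
  count (fun y => y \in Y) (nbr x).

End Tree.

(** ** Edge-indexed graphs *)

(* Graphs whose vertices form a subset of a type W. [index u v k] says that
   the index from u to v is k; it is kept as a relation, so that no junk value
   is involved where the index is an eventual value. *)
Record eigraph (W : Type) := EIGraph {
  vert : set W;
  index : W -> W -> nat -> Prop
}.

Definition edge (W : Type) (G : eigraph W) (u v : W) : Prop :=
  exists2 k, 0 < k & index G u v k.

Definition eisomorphic (W W' : Type) (G : eigraph W) (H : eigraph W') : Prop :=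
  exists f : W -> W', set_bij (vert G) (vert H) f /\
    forall u v, vert G u -> vert G v ->
      forall k, index G u v k <-> index H (f u) (f v) k.

(* x lists the vertices of G in order, starting from the end vertex; loops are
   unconstrained. *)
Definition ray_enumeration (W : Type) (G : eigraph W) (x : nat -> W) : Prop :=
  set_bij [set: nat] (vert G) x /\
  forall i j, i <> j -> (edge G (x i) (x j) <-> (j = i.+1 \/ i = j.+1)).

Section DirectLimit.
Variables (W : Type) (G : nat -> eigraph W) (e : nat -> W -> W).

Fixpoint push_by (n k : nat) (u : W) : W :=
  if k is k'.+1 then e (n + k') (push_by n k' u) else u.

(* the image of u at stage N, for u at stage n <= N *)
Definition push (n N : nat) (u : W) : W := push_by n (N - n) u.

Definition germ (m : nat) (p : nat * W) : set (nat * W) :=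
  [set q | [/\ m <= q.1, vert (G q.1) q.2 &
    exists N, [/\ p.1 <= N, q.1 <= N & push p.1 N p.2 = push q.1 N q.2]]].

Definition direct_limit (m : nat) : eigraph (set (nat * W)) := {|
  vert := [set X | exists p,
    [/\ m <= p.1, vert (G p.1) p.2 & X = germ m p]];
  index := fun X Y k => exists p q, [/\ X p, Y q &
    exists N, forall n, N <= n ->
      index (G n) (push p.1 n p.2) (push q.1 n q.2) k]
|}.

End DirectLimit.

(** ** Colorings *)

Section Coloring.
Variables (d : nat) (T : regular_tree d) (phi : T -> bool).

Definition ball_equiv (n : nat) (x y : T) : Prop :=
  exists f : T -> T, [/\ set_bij (cball n x) (cball n y) f, f x = y,
    (forall u v, cball n x u -> cball n x v -> adj (f u) (f v) = adj u v) &
    (forall u, cball n x u -> phi (f u) = phi u)].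

(* A class of n-balls is represented by the set of the centers of its balls.
   Classes of different radii may then be equal as sets, so the radius is
   always given along with the class. *)
Definition bclass (n : nat) (x : T) : set T := [set y | ball_equiv n x y].

Definition bclasses (n : nat) : set (set T) := range (bclass n).

Definition sturmian : Prop := forall n, (bclasses n #= `I_(n.+2))%card.

(* the class W of (n+1)-balls restricts to the class U of n-balls *)
Definition restricts (n : nat) (W U : set T) : Prop :=
  exists2 x, W = bclass n.+1 x & U = bclass n x.

Definition always_adjacent (D E : set T) : Prop :=
  forall x, D x -> exists2 y, E y & adj x y.

Record special_naming (a : bool) (S A B C : nat -> set T) : Prop := {
  naming_S0 : S 0 = phi @^-1` [set a];
  naming_A0 : A 0 = phi @^-1` [set a];
  naming_B0 : B 0 = phi @^-1` [set ~~ a];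
  naming_neq : forall n, A n.+1 <> B n.+1;
  naming_AS : forall n, restricts n (A n.+1) (S n);
  naming_BS : forall n, restricts n (B n.+1) (S n);
  naming_AA : forall n, always_adjacent (A n.+1) (A n);
  naming_BB : forall n, always_adjacent (B n.+1) (B n);
  naming_lt : forall n x y, A n.+1 x -> B n.+1 y ->
    nb_count y (A n) < nb_count x (A n);
  naming_C : forall n, restricts n (S n.+1) (C n)
}.

Definition bounded_type (S : nat -> set T) : Prop :=
  forall v, finite_set [set k | bclass k v = S k].

Definition color_automorphism (g : T -> T) : Prop :=
  [/\ bijective g, (forall x y, adj (g x) (g y) = adj x y) &
      (forall x, phi (g x) = phi x)].

Definition orbit (x : T) : set T :=
  [set y | exists2 g, color_automorphism g & g x = y].

Definition quotient_graph : eigraph (set T) := {|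
  vert := range orbit;
  index := fun X Y k => exists2 x, X x & nb_count x Y = k
|}.

(** *** The graphs of n-balls *)

Definition ball_edge (n : nat) (D E : set T) : Prop :=
  exists x y, [/\ adj x y, bclass n x = D & bclass n y = E].

(* The graph of n-balls has no multiple edges: going back and forth along an
   edge is not a cycle, so that cycles have at least three vertices. *)
Definition ball_cycle (n : nat) (c : seq (set T)) : Prop :=
  [/\ 2 < size c, uniq c & cycle (fun D E => `[< ball_edge n D E >]) c].

Definition S_C_on_cycle (S C : nat -> set T) (n : nat) : Prop :=
  S n <> C n /\ exists c, [/\ ball_cycle n c, S n \in c & C n \in c].

(* Below, the sequence E is one of A and B. *)
Section Star.
Variables S E : nat -> set T.

Definition star_index (n : nat) (X Y : set T) (k : nat) : Prop :=
  exists2 x, (if X == S n then E n.+1 else X) x & nb_count x Y = k.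

Definition star_step (n : nat) (X Y : set T) : Prop :=
  bclasses n Y /\ exists2 k, 0 < k & star_index n X Y k.

Definition star_graph (n : nat) : eigraph (set T) := {|
  vert := [set X | clos_refl_trans (set T) (star_step n) (S n) X];
  index := star_index n
|}.

Definition star_extension (n : nat) (U : set T) : set T :=
  if U == S n then E n.+1 else xget set0 [set W | restricts n W U].

Definition star_limit (m : nat) : eigraph (set (nat * set T)) :=
  direct_limit star_graph star_extension m.

End Star.

End Coloring.

(* Main.v *)
(* Each class of n-balls other than S n has a single extension, and the number
   of neighbors in each class of n-balls only depends on the class of
   (n+1)-balls. Call two vertices equivalent if all their balls are, and let
   the rank of a vertex be one more than the maximum of its type set. No S n
   meets finitely many equivalence classes only, and a neighbor of a vertex of
   rank t has rank at most t + 1; so if one rank is finite then all are, the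
   rank determines the equivalence class, and X_phi is a ray ordered by the
   rank. If no rank is finite, comparing the neighbors of the two parts of S n
   shows that a vertex has at most two neighbors in X_phi other than itself;
   this thus holds in all cases.

   By this degree bound every cycle of G_n goes through S n. If B n (or
   A n) is outside of the cycle, then S (n+1) is the next vertex of the cycle
   and the cycle lifts to G_(n+1) with S n replaced by A (n+1): the special
   class goes around the cycle forever and never comes back to B n, which is
   therefore settled, whence (1). A case analysis shows that every cycle leads to
   this situation, and that S n <> C n are both on a cycle of G_n if and only
   if this situation occurs at n + 1; minimality of m then shows that the
   ranks are m + 1, m + 2, ..., with B n the set of vertices of rank n for all
   n > m, whence (2) and (3). *)

Require Import Defs.
From Stdlib Require Import Relation_Operators.
From mathcomp Require Import all_boot.
From mathcomp Require Import all_classical.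
From mathcomp Require Import zify.

Set Implicit Arguments.
Unset Strict Implicit.
Unset Printing Implicit Defensive.

Local Open Scope classical_set_scope.

(** * Equivalence of balls *)


Section BallEquivalence.
Variables (d : nat) (T : regular_tree d) (phi : T -> bool).
Implicit Types (x y z u v w : T) (n k : nat).

Local Notation E := (ball_equiv phi).

Lemma adjC x y : adj x y = adj y x.
Proof. exact: nbr_sym. Qed.

Lemma adj_neq x y : adj x y -> x <> y.
Proof. by move=> xy eqxy; move: (nbr_irr x); rewrite {1}eqxy -[_ \in _]/(adj x y) xy. Qed.

Lemma cball_center n x : cball n x x.
Proof. by exists [::]. Qed.

Lemma cball_le m n x : (m <= n)%N -> cball m x `<=` cball n x.
Proof. by move=> mn y [p [xp py pm]]; exists p; split=> //; exact: leq_trans mn. Qed.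

Lemma cball_nbr n x z : adj x z -> cball n z `<=` cball n.+1 x.
Proof. by move=> xz y [p [zp py pn]]; exists (z :: p); rewrite /= xz. Qed.

Lemma cball0 x y : cball 0 x y -> y = x.
Proof. by case=> -[|z p] []. Qed.

Lemma cball_path n x p : path (@adj d T) x p -> (size p <= n)%N ->
  {in p, forall y, cball n x y}.
Proof.
move=> xp pn y /splitPr yp; case: yp xp pn => p1 p2.
rewrite cat_path size_cat /= addnS => /and3P[xp1 p1y _] pn.
exists (rcons p1 y); rewrite rcons_path xp1 p1y last_rcons size_rcons; split => //.
exact: leq_ltn_trans (leq_addr _ _) pn.
Qed.

Lemma iso_path n x p (f : T -> T) :
  (forall u v, cball n x u -> cball n x v -> adj (f u) (f v) = adj u v) ->
  forall z, cball n x z -> (forall y, y \in p -> cball n x y) ->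
  path (@adj d T) (f z) (map f p) = path (@adj d T) z p.
Proof.
move=> fadj; elim: p => //= y p IH z xz xp.
have xy : cball n x y by apply: xp; rewrite mem_head.
by rewrite fadj // IH // => t tp; apply: xp; rewrite inE tp orbT.
Qed.

Lemma ball_equiv_refl n x : E n x x.
Proof.
exists id; split=> //; split=> //.
by move=> y xy; exists y.
Qed.

Lemma ball_equiv_sym n x y : E n x y -> E n y x.
Proof.
move=> [f [[fB finj fsurj] fx fadj fphi]].
pose g v := xget x [set u | cball n x u /\ f u = v].
have gP v : cball n y v -> cball n x (g v) /\ f (g v) = v.
  move=> yv; have [u xu fu] := fsurj _ yv.
  by apply: (@xgetI _ x [set u | cball n x u /\ f u = v] u).
have gf u : cball n x u -> g (f u) = u.
  move=> xu; have [xg fg] := gP _ (fB _ xu).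
  by apply: finj fg; rewrite inE.
exists g; split.
- split; first by move=> v /gP[].
  + move=> u v; rewrite !inE => /gP[_ fu] /gP[_ fv] guv.
    by rewrite -fu -fv guv.
  + by move=> u xu; exists (f u); [exact: fB|exact: gf].
- by rewrite -fx gf //; exact: cball_center.
- by move=> u v /gP[gu fu] /gP[gv fv]; rewrite -fadj // fu fv.
- by move=> u /gP[gu fu]; rewrite -fphi // fu.
Qed.

Lemma ball_equiv_trans n y x z : E n x y -> E n y z -> E n x z.
Proof.
move=> [f [[fB finj fsurj] fx fadj fphi]] [g [[gB ginj gsurj] gy gadj gphi]].
exists (g \o f); split.
- split; first by move=> u xu; apply: gB; exact: fB.
  + move=> u v; rewrite !inE => xu xv /= guv; apply: finj; rewrite ?inE //.
    by apply: ginj; rewrite ?inE //; exact: fB.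
  + move=> w /gsurj[v /fsurj[u xu <-] <-]; by exists u.
- by rewrite /= fx.
- by move=> u v xu xv /=; rewrite gadj ?fadj //; exact: fB.
- by move=> u xu /=; rewrite gphi ?fphi //; exact: fB.
Qed.

Lemma ball_equiv0 x y : E 0 x y <-> phi x = phi y.
Proof.
split=> [[f [_ fx _ fphi]]|xy].
  by rewrite -fx fphi //; exact: cball_center.
exists (fun=> y); split=> //.
- split; first by move=> u _; exact: cball_center.
    by move=> u v; rewrite !inE => /cball0-> /cball0->.
  by move=> v /cball0->; exists x => //; exact: cball_center.
- by move=> u v /cball0-> /cball0->; rewrite /adj !(negbTE (nbr_irr _)).
- by move=> u /cball0->.
Qed.

(** Paths of the small ball stay in the large one, so [f] carries them forward; the inclusion in
    [cball n.+1 y] lets paths around [f z] be lifted back. Used for the center and for its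
    neighbors. *)
Lemma sub_ball_equiv n x y z (f : T -> T) :
    set_bij (cball n.+1 x) (cball n.+1 y) f ->
    (forall u v, cball n.+1 x u -> cball n.+1 x v -> adj (f u) (f v) = adj u v) ->
    (forall u, cball n.+1 x u -> phi (f u) = phi u) ->
  cball n z `<=` cball n.+1 x -> cball n (f z) `<=` cball n.+1 y ->
  E n z (f z).
Proof.
move=> [fB finj fsurj] fadj fphi zx fzy.
have xz : cball n.+1 x z by apply: zx; exact: cball_center.
exists f; split=> //; last first.
- by move=> u zu; apply: fphi; exact: zx.
- by move=> u v zu zv; apply: fadj; exact: zx.
split.
- move=> u [p [zp pu pn]]; exists (map f p); split.
  + rewrite (iso_path fadj) // => t tp.
    by apply: zx; exact: cball_path tp.
  + by rewrite last_map pu.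
  + by rewrite size_map.
- by move=> u v; rewrite !inE => zu zv; apply: finj; rewrite inE; exact: zx.
- move=> v [q [zq qv qn]].
  have [p qp px] : exists2 p, q = map f p & forall t, t \in p -> cball n.+1 x t.
    have : forall t, t \in q -> cball n.+1 y t.
      by move=> t tq; apply: fzy; exact: cball_path tq.
    elim: q {zq qv qn} => [|t q IH] qy; first by exists [::].
    have [|p -> px] := IH; first by move=> w wq; apply: qy; rewrite inE wq orbT.
    have [u xu <-] := fsurj t (qy t (mem_head _ _)).
    by exists (u :: p) => // w; rewrite inE => /orP[/eqP->//|/px].
  move: zq; rewrite qp (iso_path fadj) // => zp.
  exists (last z p); last by rewrite -last_map -qp.
  by exists p; split=> //; rewrite -(size_map f) -qp.
Qed.

Lemma ball_equivS n x y : E n.+1 x y -> E n x y.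
Proof.
move=> [f [fbij fx fadj fphi]]; rewrite -fx.
apply: (sub_ball_equiv fbij fadj fphi); first exact: cball_le.
by rewrite fx; exact: cball_le.
Qed.

Lemma ball_equiv_le m n x y : (m <= n)%N -> E n x y -> E m x y.
Proof.
by move=> /subnK <-; elim: (n - m)%N => //= k IH; rewrite addSn => /ball_equivS.
Qed.

(** The isomorphism permutes the neighbors of the centers, and the [n]-balls around these lie inside
    the [n.+1]-balls, so it preserves their classes. *)
Lemma ball_equiv_count n x y z : E n.+1 x y ->
  nb_count x (bclass phi n z) = nb_count y (bclass phi n z).
Proof.
move=> [f [fbij fx fadj fphi]].
have [fB finj fsurj] := fbij.
have nx t : t \in nbr x -> cball n.+1 x t.
  by move=> xt; apply: (cball_nbr xt); exact: cball_center.
have cx := cball_center n.+1 x.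
have fE t : t \in nbr x -> E n t (f t).
  move=> xt; apply: (sub_ball_equiv fbij fadj fphi); first exact: cball_nbr.
  by apply: cball_nbr; rewrite -fx fadj //; exact: nx.
have : perm_eq (map f (nbr x)) (nbr y).
  apply: uniq_perm; [|exact: nbr_uniq|].
    rewrite map_inj_in_uniq ?nbr_uniq // => u v /nx xu /nx xv.
    by apply: finj; rewrite inE.
  move=> v; apply/mapP/idP => [[u xu ->]|yv].
    by rewrite -[_ \in _]/(adj _ _) -fx fadj //; exact: nx.
  have /fsurj[u xu fu] : cball n.+1 y v.
    by apply: (cball_nbr yv); exact: cball_center.
  exists u => //; rewrite -[_ \in _]/(adj _ _) -fadj // fx fu //.
rewrite /nb_count => /permP <-; rewrite count_map.
apply: eq_in_count => t xt /=.
apply/idP/idP; rewrite !inE => h; first exact: ball_equiv_trans h (fE _ xt).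
by apply: ball_equiv_trans h _; apply: ball_equiv_sym; exact: fE.
Qed.

Lemma ball_equiv_adj n x y z : E n.+1 x y -> adj x z ->
  exists2 w, adj y w & E n z w.
Proof.
move=> /(ball_equiv_count z) xy xz.
have : has (fun t => t \in bclass phi n z) (nbr y).
  rewrite has_count -[count _ _]/(nb_count _ _) -xy -has_count.
  by apply/hasP; exists z => //; rewrite inE; exact: ball_equiv_refl.
by move=> /hasP[w yw]; rewrite inE; exists w.
Qed.

Lemma bclass_eqP n x y : bclass phi n x = bclass phi n y <-> E n x y.
Proof.
split=> [xy|xy].
  have : bclass phi n x x by exact: ball_equiv_refl.
  by rewrite xy => /ball_equiv_sym.
apply/seteqP; split=> z; rewrite /bclass /=.
  by apply: ball_equiv_trans; exact: ball_equiv_sym.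
exact: ball_equiv_trans.
Qed.

End BallEquivalence.

(** * Splitting of the special classes *)


Lemma uniq4 (U : eqType) (a b c e : U) :
  a <> b -> a <> c -> a <> e -> b <> c -> b <> e -> c <> e ->
  uniq [:: a; b; c; e].
Proof.
by rewrite /= !inE !negb_or => /eqP-> /eqP-> /eqP-> /eqP-> /eqP-> /eqP->.
Qed.

Section Splitting.
Variables (d : nat) (T : regular_tree d) (phi : T -> bool).
Implicit Types (x y z u v w : T) (n k : nat) (X Y Z : set T).

Local Notation E := (ball_equiv phi).
Local Notation cl := (bclass phi).

Lemma bclass_self n x : cl n x x.
Proof. exact: ball_equiv_refl. Qed.

Lemma bclasses_eq n X x : bclasses phi n X -> X x -> X = cl n x.
Proof. by move=> [y _ <-] yx; apply/bclass_eqP. Qed.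

(* The symmetric part of [special_naming]: exchanging A and B preserves it. *)
Record splitting (S A B C : nat -> set T) : Prop := Splitting {
  split_S : forall n, bclasses phi n (S n);
  split_A : forall n, bclasses phi n (A n);
  split_B : forall n, bclasses phi n (B n);
  split_C : forall n, bclasses phi n (C n);
  split_AB : forall n x, A n x -> B n x -> False;
  split_AB0 : forall x, A 0 x \/ B 0 x;
  split_SAB : forall n x, S n x <-> A n.+1 x \/ B n.+1 x;
  split_AA : forall n, always_adjacent (A n.+1) (A n);
  split_BB : forall n, always_adjacent (B n.+1) (B n);
  split_SC : forall n, S n.+1 `<=` C n;
  split_stable : forall n x y, ~ S n x -> E n x y -> E n.+1 x y;
  split_reps : forall n, exists l : seq T, forall x, exists2 z, z \in l & E n x z;
  split_card : forall n (s : seq (set T)), uniq s ->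
    (forall X, X \in s -> bclasses phi n X) -> size s <= n.+2
}.

Lemma splitting_sym S A B C : splitting S A B C -> splitting S B A C.
Proof.
case=> hS hA hB hC hAB hAB0 hSAB hAA hBB hSC hst hr hc; split=> //.
- by move=> n x Bx Ax; exact: hAB Ax Bx.
- by move=> x; case: (hAB0 x); [right|left].
- by move=> n x; rewrite hSAB; split=> -[]; by [left|right].
Qed.

(** * Counting of extensions under a special naming *)

Section Naming.
Variables (a : bool) (S A B C : nat -> set T).
Hypothesis (hphi : sturmian phi) (hname : special_naming phi a S A B C).

Lemma bclasses_enum n : exists s : seq (set T),
  [/\ uniq s, size s = n.+2 & forall X, (X \in s) <-> bclasses phi n X].
Proof.
have fin : finite_set (bclasses phi n).
  by apply/finite_setP; exists n.+2; exact: hphi.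
exists (finmap.enum_fset (fset_set (bclasses phi n))); split.
- exact: finmap.fset_uniq.
- by apply/card_eq_fsetP; rewrite fset_setK.
- move=> X; rewrite (_ : (X \in _) = (X \in bclasses phi n)) ?inE //.
  exact: (in_fset_set fin X).
Qed.

Lemma bclasses_card n (s : seq (set T)) : uniq s ->
  (forall X, X \in s -> bclasses phi n X) -> size s <= n.+2.
Proof.
move=> us sP; have [t [ut <- tP]] := bclasses_enum n.
by apply: uniq_leq_size => // X /sP /tP.
Qed.

Lemma bclasses_reps n : exists l : seq T, forall x, exists2 z, z \in l & E n x z.
Proof.
have [t [_ _ tP]] := bclasses_enum n.
have [x0 _] := tree_inhabited T.
exists (map (xget x0) t) => x.
exists (xget x0 (cl n x)); last exact: (xgetI x0 (bclass_self n x)).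
by apply: map_f; apply/tP; exists x.
Qed.

(* Going from n to n + 1, the number of classes increases by one. *)
Lemma size_bclassS n (r : seq T) : uniq (map (cl n.+1) r) ->
  size r <= (size (undup (map (cl n) r))).+1.
Proof.
move=> ur; have [t [ut st tP]] := bclasses_enum n.
have [x0 _] := tree_inhabited T.
pose t' := [seq Z <- t | Z \notin map (cl n) r].
have t'P Z : Z \in t' -> Z = cl n (xget x0 Z) /\ Z \notin map (cl n) r.
  rewrite mem_filter => /andP[Zr /tP nZ]; split=> //; apply: bclasses_eq => //.
  by case: nZ => z _ <-; exact: (xgetI x0 (bclass_self n z)).
(* Each class of [n]-balls not met by [r] contributes at least one class of [n.+1]-balls of its
   own. *)
have ut' : uniq (map (cl n.+1) (r ++ map (xget x0) t')).
  rewrite map_cat cat_uniq ur -map_comp /=; apply/andP; split.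
    apply/hasPn => _ /mapP[Z /t'P[eZ Zr] ->]; apply/negP => /= /mapP[x xr ex].
    move: Zr; rewrite eZ => /negP; apply; apply/mapP; exists x => //.
    by apply/bclass_eqP; apply: ball_equivS; apply/bclass_eqP.
  rewrite map_inj_in_uniq; first exact: filter_uniq.
  move=> Y Z /t'P[eY _] /t'P[eZ _] /= /bclass_eqP /ball_equivS /bclass_eqP.
  by rewrite -eY -eZ.
have := bclasses_card ut'.
rewrite size_map size_cat size_map => /(_ n.+1).
have -> : size t' = n.+2 - size (undup (map (cl n) r)).
  rewrite -st /t' size_filter -(count_predC [in map (cl n) r] t).
  have -> : count [in map (cl n) r] t = size (undup (map (cl n) r)).
    rewrite -size_filter; apply: perm_size; apply: uniq_perm.
    - exact: filter_uniq.
    - exact: undup_uniq.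
    - move=> Z; rewrite mem_filter mem_undup /= andb_idr // => /mapP[x _ ->].
      by apply/tP; exists x.
  by rewrite addKn; exact: eq_count.
have : size (undup (map (cl n) r)) <= n.+2.
  apply: bclasses_card; first exact: undup_uniq.
  by move=> Z; rewrite mem_undup => /mapP[x _ ->]; exists x.
move=> le1 /(_ _) le2.
have {}le2 : size r + (n.+2 - size (undup (map (cl n) r))) <= n.+3.
  by apply: le2 => Z /mapP[x _ ->]; exists x.
by rewrite -(leq_add2r (n.+2 - size (undup (map (cl n) r)))) addSn subnKC.
Qed.

Lemma naming_splitting : splitting S A B C.
Proof.
have hSn n : bclasses phi n (S n).
  by have [x _ ->] := naming_AS hname n; exists x.
have hA1 n : bclasses phi n.+1 (A n.+1) /\ A n.+1 `<=` S n.
  have [x -> ->] := naming_AS hname n; split; first by exists x.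
  by move=> y /ball_equivS.
have hB1 n : bclasses phi n.+1 (B n.+1) /\ B n.+1 `<=` S n.
  have [x -> ->] := naming_BS hname n; split; first by exists x.
  by move=> y /ball_equivS.
have hCn n : bclasses phi n (C n) /\ S n.+1 `<=` C n.
  have [x -> ->] := naming_C hname n; split; first by exists x.
  by move=> y /ball_equivS.
have cl0 x : cl 0 x = phi @^-1` [set phi x].
  apply/seteqP; split=> y /=; first by move=> /ball_equiv0.
  by move=> h; apply/ball_equiv0.
have hA n : bclasses phi n (A n).
  case: n => [|n]; last by case: (hA1 n).
  by rewrite (naming_A0 hname) -(naming_S0 hname); exact: (hSn 0).
have hB n : bclasses phi n (B n).
  case: n => [|n]; last by case: (hB1 n).
  have [[x _ xB] _] := hB1 0.
  have Bx : B 1 x by rewrite -xB; exact: bclass_self.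
  have [y By _] := naming_BB hname Bx.
  exists y => //; move: By; rewrite cl0 (naming_B0 hname) /= => ->.
  by [].
have hAB n x : A n x -> B n x -> False.
  case: n => [|n] Ax Bx.
    move: Ax Bx; rewrite (naming_A0 hname) (naming_B0 hname) /= => ->.
    by case: a.
  apply: (@naming_neq _ _ _ _ _ _ _ _ hname n).
  by rewrite (bclasses_eq (hA _) Ax) (bclasses_eq (hB _) Bx).
have rep n X : bclasses phi n X -> exists x, X x.
  by move=> [x _ <-]; exists x; exact: bclass_self.
have neqAB n u v : A n.+1 u -> B n.+1 v -> cl n.+1 u <> cl n.+1 v.
  move=> Au Bv; rewrite -(bclasses_eq (hA _) Au) -(bclasses_eq (hB _) Bv).
  exact: naming_neq hname n.
have hSAB n x : S n x <-> A n.+1 x \/ B n.+1 x.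
  split=> [Sx|[]]; [|exact: (hA1 n).2|exact: (hB1 n).2].
  apply: contrapT => /not_orP[nAx nBx].
  have [u Au] := rep _ _ (hA n.+1); have [v Bv] := rep _ _ (hB n.+1).
  (* [u], [v] and [x] all lie in [S n]: three classes above a single one exceed the allowed increase
     of one. *)
  have := @size_bclassS n [:: u; v; x].
  have Su := bclasses_eq (hSn n) ((hA1 n).2 _ Au).
  have Sv := bclasses_eq (hSn n) ((hB1 n).2 _ Bv).
  rewrite /= -Su -Sv -(bclasses_eq (hSn n) Sx) !inE eqxx /= => h.
  suff /h : [&& ~~ ((cl n.+1 u == cl n.+1 v) || (cl n.+1 u == cl n.+1 x)),
    cl n.+1 v != cl n.+1 x & true] by [].
  rewrite andbT negb_or; apply/andP; split; first (apply/andP; split).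
  - by apply/eqP; exact: neqAB.
  - apply/eqP; rewrite -(bclasses_eq (hA _) Au) => e; apply: nAx.
    by rewrite e; exact: bclass_self.
  - apply/eqP; rewrite -(bclasses_eq (hB _) Bv) => e; apply: nBx.
    by rewrite e; exact: bclass_self.
split=> //.
- by move=> n; case: (hCn n).
- move=> x; rewrite (naming_A0 hname) (naming_B0 hname) /=.
  by case: (phi x); case: a; [left|right|right|left].
- exact: naming_AA hname.
- exact: naming_BB hname.
- by move=> n; case: (hCn n).
- move=> n x y nSx xy; apply: contrapT => nxy.
  have [u Au] := rep _ _ (hA n.+1); have [v Bv] := rep _ _ (hB n.+1).
  (* Here four classes would lie above at most two: the two parts of [S n], and two extensions of
     the class of [x]. *)
  have := @size_bclassS n [:: u; v; x; y].
  have Su := bclasses_eq (hSn n) ((hA1 n).2 _ Au).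
  have Sv := bclasses_eq (hSn n) ((hB1 n).2 _ Bv).
  have nSy : ~ S n y.
    by rewrite (bclasses_eq (hSn n) ((hA1 n).2 _ Au)) => uy; apply: nSx;
      rewrite Su; exact: ball_equiv_trans uy (ball_equiv_sym xy).
  have nS w z : S n w -> ~ S n z -> cl n.+1 w <> cl n.+1 z.
    move=> Sw nSz /bclass_eqP /ball_equivS wz; apply: nSz.
    by rewrite (bclasses_eq (hSn n) Sw).
  have Sun := (hA1 n).2 _ Au; have Svn := (hB1 n).2 _ Bv.
  have le2 : size (undup (map (cl n) [:: u; v; x; y])) <= 2.
    apply: (@uniq_leq_size _ _ [:: S n; cl n x]) => [|Z]; first exact: undup_uniq.
    have -> : map (cl n) [:: u; v; x; y] = [:: S n; S n; cl n x; cl n x].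
      by rewrite /= -Su -Sv; congr [:: _; _; _; _]; apply/bclass_eqP; exact: ball_equiv_sym.
    by rewrite mem_undup !inE orbA orbb orbb.
  suff ur : uniq (map (cl n.+1) [:: u; v; x; y]).
    by move=> /(_ ur) /leq_trans /(_ (le2 : _.+1 <= 3)).
  apply: uniq4; try exact: neqAB; try exact: nS.
  by move/bclass_eqP.
- exact: bclasses_reps.
- exact: bclasses_card.
Qed.

End Naming.
End Splitting.

(** * Type sets *)


Section Types.
Variables (d : nat) (T : regular_tree d) (phi : T -> bool).
Implicit Types (x y z u v w : T) (n k : nat) (X Y Z : set T) (l : seq T).

Local Notation E := (ball_equiv phi).
Local Notation cl := (bclass phi).

Lemma class_equiv n X x y : bclasses phi n X -> X x -> X y -> E n x y.
Proof. by move=> nX Xx; rewrite (bclasses_eq nX Xx). Qed.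

Lemma class_closed n X x y : bclasses phi n X -> X x -> E n x y -> X y.
Proof. by move=> nX Xx; rewrite (bclasses_eq nX Xx). Qed.

Lemma class_inh n X : bclasses phi n X -> exists x, X x.
Proof. by move=> [x _ <-]; exists x; exact: bclass_self. Qed.

Lemma tree_connect (P : T -> Prop) x :
  P x -> (forall u v, P u -> adj u v -> P v) -> forall y, P y.
Proof.
move=> Px Padj y; have [p] := tree_connected x y.
elim: p x Px => [|z p IH] x Px /=; first by move=> _ <-.
by move=> /andP[xz] /IH; apply; exact: Padj xz.
Qed.

Definition equiv_all x y := forall n, E n x y.

Lemma equiv_all_sym x y : equiv_all x y -> equiv_all y x.
Proof. by move=> h n; exact: ball_equiv_sym. Qed.

Lemma uniform_level (P : nat -> T -> Prop) l :
  (forall m n z, m <= n -> P m z -> P n z) ->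
  (forall z, z \in l -> exists n, P n z) -> exists n, forall z, z \in l -> P n z.
Proof.
move=> Pmono; elim: l => [|z l IH] Pl; first by exists 0.
have [|n nP] := IH; first by move=> w wl; apply: Pl; rewrite inE wl orbT.
have [m mP] := Pl z (mem_head _ _).
exists (maxn m n) => w; rewrite inE => /orP[/eqP->|/nP].
  by apply: Pmono mP; exact: leq_maxl.
by apply: Pmono; exact: leq_maxr.
Qed.

Lemma equiv_all_level y l :
  exists n, forall z, z \in l -> E n y z -> equiv_all y z.
Proof.
apply: (uniform_level (P := fun n z => E n y z -> equiv_all y z)).
  by move=> m n z mn Pz /(ball_equiv_le mn).
move=> z _; case: (pselect (equiv_all y z)) => [yz|/existsNP[n yz]].
  by exists 0.
by exists n => /yz.
Qed.

Lemma equiv_all_separation l : exists n, forall y z,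
  y \in l -> z \in l -> E n y z -> equiv_all y z.
Proof.
have [||n nP] := @uniform_level
    (fun n y => forall z, z \in l -> E n y z -> equiv_all y z) l.
- by move=> m n y mn Py z zl /(ball_equiv_le mn); exact: Py.
- by move=> y _; exact: equiv_all_level.
- by exists n => y z yl zl; exact: nP.
Qed.

(** The radius from [equiv_all_level] separates [y] from all inequivalent members of [l], so a match
    at that radius is a match at all radii. *)
Lemma equiv_all_pigeonhole y l :
  (forall n, exists2 z, z \in l & E n y z) -> exists2 z, z \in l & equiv_all y z.
Proof.
move=> h; have [n nP] := equiv_all_level y l; have [z zl yz] := h n.
by exists z => //; exact: nP.
Qed.

Lemma equiv_all_adj x y z : equiv_all x y -> adj x z ->
  exists2 w, adj y w & equiv_all z w.
Proof.
by move=> xy xz; apply: equiv_all_pigeonhole => n; exact: ball_equiv_adj xz.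
Qed.

(** Finiteness up to [equiv_all]; the representatives in [l] need not belong to [X]. *)
Definition few X := exists l, forall x, X x -> exists2 z, z \in l & equiv_all x z.

Variables S A B C : nat -> set T.
Hypothesis hs : splitting phi S A B C.

Lemma splitS_inh n :
  exists x y, [/\ S n x, S n y, E n x y & ~ E n.+1 x y].
Proof.
have [x Ax] := class_inh (split_A hs n.+1).
have [y By] := class_inh (split_B hs n.+1).
have Sx : S n x by apply/(split_SAB hs); left.
have Sy : S n y by apply/(split_SAB hs); right.
exists x, y; split=> //; first exact: class_equiv (split_S hs n) Sx Sy.
by move=> /(class_closed (split_A hs n.+1) Ax) Ay; exact: (split_AB hs Ay By).
Qed.

(** [S n.+1] splits into [A n.+2] and [B n.+2], which are always adjacent to [A n.+1] and [B n.+1],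
    the two parts of [S n]. *)
Lemma special_adj n x : S n.+1 x -> exists2 y, S n y & adj x y.
Proof.
move=> /(split_SAB hs) [/(split_AA hs)|/(split_BB hs)] [y Yy xy]; exists y => //;
  by apply/(split_SAB hs); by [left|right].
Qed.

Lemma few_specialS n : few (S n) -> few (S n.+1).
Proof.
move=> [l lP]; exists (flatten (map (@nbr d T) l)) => x /special_adj[y Sy xy].
have [z zl yz] := lP y Sy.
have [w zw xw] : exists2 w, adj z w & equiv_all x w.
  by apply: equiv_all_adj yz _; rewrite adjC.
by exists w => //; apply/flatten_mapP; exists z.
Qed.

Definition settled t x := forall n, t <= n -> ~ S n x.

Lemma settled_le s t x : s <= t -> settled s x -> settled t x.
Proof. by move=> st h n tn; apply: h; exact: leq_trans tn. Qed.

Lemma settled_equiv t x y : settled t x -> E t x y -> equiv_all x y.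
Proof.
move=> tx xy n; apply: (@ball_equiv_le _ _ _ n (t + n)); first exact: leq_addl.
elim: n => [|n IH]; first by rewrite addn0.
by rewrite addnS; apply: (split_stable hs) => //; apply: tx; exact: leq_addr.
Qed.

Lemma equiv_all_settled t x y : equiv_all x y -> settled t x -> settled t y.
Proof.
move=> xy tx n tn Sy; apply: (tx n tn).
exact: class_closed (split_S hs n) Sy (ball_equiv_sym (xy n)).
Qed.

(* Otherwise all of the tree would fall into finitely many classes, and these
   would not split beyond the level that separates them. *)
Lemma special_not_few n : ~ few (S n).
Proof.
move=> fewn.
have {}fewn k : n <= k -> few (S k).
  move=> /subnK <-; elim: (k - n) => //= j; exact: few_specialS.
have fewcl z : few (cl n z).
  (* A class that is never special from level [n] on does not split. Otherwise it keeps the same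
     vertices up to the first level [j] at which it is special, and [S j] is few. *)
  case: (pselect (settled n z)) => [nz|].
    exists [:: z] => x zx; exists z; rewrite ?mem_head //.
    by apply: equiv_all_sym; exact: settled_equiv zx.
  move=> /existsNP[k /not_implyP[nk /contrapT Sz]].
  pose P k := `[< n <= k /\ S k z >].
  have exP : exists k, P k by exists k; apply/asboolP.
  have [j /asboolP[{}nj {}Sj] jmin] := ex_minnP exP.
  have [l lP] := fewn _ nj; exists l => x zx; apply: lP.
  apply: (class_closed (split_S hs j) Sj).
  have {}jmin i : n <= i < j -> ~ S i z.
    move=> /andP[ni ij] Si; have : P i by apply/asboolP.
    by move=> /jmin; rewrite leqNgt ij.
  elim: j nj jmin {Sj} => [|j IH] nj jmin.
    by move: nj; rewrite leqn0 => /eqP <-.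
  move: nj; rewrite leq_eqVlt => /orP[/eqP <- //|nj].
  apply: (split_stable hs); first by apply: jmin; rewrite ltnSn andbT.
  apply: IH => // i /andP[ni ij]; apply: jmin; rewrite ni /=.
  exact: ltn_trans ij _.
have [r rP] := split_reps hs n.
have [l lP] : exists l, forall x, (exists2 z, z \in r & E n x z) ->
    exists2 z, z \in l & equiv_all x z.
  elim: r {rP} => [|z r [l lP]]; first by exists [::] => x [].
  have [l' l'P] := fewcl z; exists (l' ++ l) => x [w].
  rewrite inE => /orP[/eqP->|wr] xw.
    have [v vl xv] := l'P x (ball_equiv_sym xw).
    by exists v; rewrite // mem_cat vl.
  have [v vl xv] := lP x (ex_intro2 _ _ w wr xw).
  by exists v; rewrite // mem_cat vl orbT.
(* [l] now represents the whole tree, so nothing would split beyond level [k]; yet [S k] does. *)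
have [k kP] := equiv_all_separation l.
have [x [y [_ _ xy]]] := splitS_inh k; apply.
have [u ul xu] := lP x (rP x); have [v vl yv] := lP y (rP y).
apply: (ball_equiv_trans (xu _)); apply: ball_equiv_sym.
apply: (ball_equiv_trans (yv _)); apply: (kP v u vl ul).
apply: ball_equiv_trans (xu _); apply: ball_equiv_trans (ball_equiv_sym xy).
exact: ball_equiv_sym.
Qed.

(** If [y] were in [S n.+1] with [t <= n], every vertex of [S n.+1] would have a neighbor with the
    [n]-ball of [x], hence equivalent to [x], and would itself be equivalent to a neighbor of [x]:
    [S n.+1] would be few. *)
Lemma settled_adj t x y : settled t x -> adj x y -> settled t.+1 y.
Proof.
move=> tx xy [//|n] tn Sy; apply: (@special_not_few n.+1).
exists (nbr x) => u Su.
have yx : adj y x by rewrite adjC.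
have [w uw xw] := ball_equiv_adj (class_equiv (split_S hs _) Sy Su) yx.
have {}xw : equiv_all w x.
  by apply: equiv_all_sym; apply: settled_equiv xw; exact: settled_le tx.
have wu : adj w u by rewrite adjC.
by have [v xv uv] := equiv_all_adj xw wu; exists v.
Qed.

End Types.

(** * Ranks *)


Section Rank.
Variables (d : nat) (T : regular_tree d) (phi : T -> bool).
Implicit Types (x y z u v w : T) (n k : nat) (X Y Z : set T) (l : seq T).

Local Notation E := (ball_equiv phi).

Variables S A B C : nat -> set T.
Hypothesis hs : splitting phi S A B C.

(* In the quotient, a vertex has at most two neighbors other than itself. *)
Definition linear := forall n x y1 y2 y3,
  adj x y1 -> adj x y2 -> adj x y3 ->
  ~ E n x y1 -> ~ E n x y2 -> ~ E n x y3 ->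
  ~ E n y1 y2 -> ~ E n y1 y3 -> ~ E n y2 y3 -> False.

(** A vertex [x'] of the other part of [S k.+1] has a neighbor [v'] with the [k]-ball of [v]. As [v]
    is special at none of three levels, [v] and [v'] agree up to radius [k.+3], so [v] has a
    neighbor that resembles [x']. *)
Lemma special_adj_both k x v : S k.+1 x -> adj x v ->
  ~ S k v -> ~ S k.+1 v -> ~ S k.+2 v ->
  exists w, [/\ adj v w, E k.+1 x w & ~ E k.+2 x w].
Proof.
move=> Sx xv n0 n1 n2.
have [x' Sx' xx'] : exists2 x', S k.+1 x' & ~ E k.+2 x x'.
  have [y [z [Sy Sz _ yz]]] := splitS_inh hs k.+1.
  case: (pselect (E k.+2 x y)) => [xy|]; last by exists y.
  exists z => // xz; apply: yz.
  exact: ball_equiv_trans (ball_equiv_sym xy) xz.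
have Exx' := class_equiv (split_S hs _) Sx Sx'.
have [v' xv' vv'] := ball_equiv_adj Exx' xv.
do 3!(move/(split_stable hs): vv' => /(_ ltac:(assumption)) vv').
have vx' : adj v' x' by rewrite adjC.
have [w vw xw] := ball_equiv_adj (ball_equiv_sym vv') vx'.
exists w; split=> //.
  exact: ball_equiv_trans Exx' (ball_equivS xw).
by move=> h; apply: xx'; exact: ball_equiv_trans h (ball_equiv_sym xw).
Qed.

(** Take [k] large with [x] in [S k.+1]. A neighbor special at none of [k], [k.+1], [k.+2] would
    touch both parts of [S k.+1], against the choice of [K]. Level [k.+1] is taken by [x], and
    levels [k] and [k.+2] serve one neighbor each: three are too many. *)
Lemma unsettled_degree n x y1 y2 y3 : (forall t, ~ settled S t x) ->
  adj x y1 -> adj x y2 -> adj x y3 ->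
  ~ E n x y1 -> ~ E n x y2 -> ~ E n x y3 ->
  ~ E n y1 y2 -> ~ E n y1 y3 -> ~ E n y2 y3 -> False.
Proof.
move=> hx x1 x2 x3 n1 n2 n3 n12 n13 n23.
have [K KP] := equiv_all_separation phi (x :: nbr y1 ++ nbr y2 ++ nbr y3).
have [k [nk Kk Sx]] : exists k, [/\ n <= k, K <= k.+1 & S k.+1 x].
  have /existsNP[t /not_implyP[]] := hx (maxn n.+1 K).
  by rewrite geq_max => /andP[]; case: t => // k nk Kk /contrapT Sx; exists k.
have bad v : adj x v -> v \in [:: y1; y2; y3] ->
    ~ S k v -> ~ S k.+1 v -> ~ S k.+2 v -> False.
  move=> xv vy nS0 nS1 nS2.
  have [w [vw xw]] := special_adj_both Sx xv nS0 nS1 nS2; apply.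
  apply: KP; rewrite ?mem_head //; last exact: ball_equiv_le xw.
  rewrite inE !mem_cat; move: vy vw; rewrite !inE /adj.
  by move=> /or3P[]/eqP-> ->; rewrite ?orbT.
have le m u v : k <= m -> S m u -> S m v -> E n u v.
  move=> km Su Sv; apply: ball_equiv_le (class_equiv (split_S hs m) Su Sv).
  exact: leq_trans km.
have k1 := leqnSn k; have k2 : k <= k.+2 by rewrite -addn2 leq_addr.
have nS1 v : ~ E n x v -> ~ S k.+1 v by move=> xv Sv; apply: xv; exact: le Sx Sv.
have b1 := bad y1 x1; have b2 := bad y2 x2; have b3 := bad y3 x3.
rewrite !inE !eqxx ?orbT in b1 b2 b3.
have {}b1 := b1 isT; have {}b2 := b2 isT; have {}b3 := b3 isT.
have {}le m u v : k <= m -> ~ E n u v -> S m u -> S m v -> False.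
  by move=> km uv Su Sv; exact: uv (le m u v km Su Sv).
have h0 u v := le k u v (leqnn k); have h2 u v := le k.+2 u v k2.
have a1 := nS1 _ n1; have a2 := nS1 _ n2; have a3 := nS1 _ n3.
have a4 := h0 _ _ n12; have a5 := h0 _ _ n13; have a6 := h0 _ _ n23.
have a7 := h2 _ _ n12; have a8 := h2 _ _ n13; have a9 := h2 _ _ n23.
clear -b1 b2 b3 a1 a2 a3 a4 a5 a6 a7 a8 a9.
case: (EM (S k y1)) (EM (S k y2)) (EM (S k y3)) (EM (S k.+2 y1))
  (EM (S k.+2 y2)) (EM (S k.+2 y3)); tauto.
Qed.

(* The rank of a vertex is one more than the maximum of its type set, and 0
   if the type set is empty; it is meaningful for finite type sets only. *)
Definition rank x : nat :=
  xget 0 [set t | settled S t x /\ forall s, settled S s x -> t <= s].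

Hypothesis hb : forall x, exists t, settled S t x.

Lemma rankP x t : settled S t x <-> rank x <= t.
Proof.
move: t.
have [rx rmin] : settled S (rank x) x /\ forall s, settled S s x -> rank x <= s.
  have ex : exists t, `[< settled S t x >].
    by have [t tx] := hb x; exists t; apply/asboolP.
  have [t /asboolP tx tmin] := ex_minnP ex.
  have tP : settled S t x /\ forall s, settled S s x -> t <= s.
    by split=> // s sx; apply: tmin; apply/asboolP.
  exact: (@xgetI _ 0 [set t | settled S t x /\
    forall s, settled S s x -> t <= s] t tP).
move=> t; split; first exact: rmin.
by move=> rt; exact: settled_le rx.
Qed.

Lemma special_lt_rank n x : S n x -> n < rank x.
Proof.
by move=> Sx; rewrite ltnNge; apply/negP => /rankP /(_ n (leqnn _)).
Qed.

Lemma rank_special n x : rank x = n.+1 -> S n x.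
Proof.
move=> rx; apply: contrapT => nS; have : ~ settled S n x.
  by move=> /rankP; rewrite rx ltnn.
apply=> m; rewrite leq_eqVlt => /orP[/eqP <- //|nm].
by move: m nm; apply/rankP; rewrite rx.
Qed.

Lemma rank_adj x y : adj x y -> rank y <= (rank x).+1.
Proof. by move=> xy; apply/rankP; apply: (settled_adj hs _ xy); exact/rankP. Qed.

Lemma equiv_all_rank x y : equiv_all phi x y -> rank x = rank y.
Proof.
move=> xy; apply/eqP; rewrite eqn_leq; apply/andP; split; apply/rankP.
  by apply: (equiv_all_settled hs (equiv_all_sym xy)); apply/rankP.
by apply: (equiv_all_settled hs xy); apply/rankP.
Qed.

Lemma rank_le_equiv n x y : rank x <= n -> E n x y -> equiv_all phi x y.
Proof. by move=> /rankP rx; exact: (settled_equiv hs rx). Qed.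

(** Vertices of rank [n.+1] lie in [S n] and are settled at [n.+1]; two of them in different parts
    would represent all of [S n], which is not few. At rank 0 both vertices lie in the class of
    0-balls other than [S 0]. *)
Lemma rank_equiv x y : rank x = rank y -> equiv_all phi x y.
Proof.
case: (posnP (rank x)) => [rx /esym ry|].
  apply: (@rank_le_equiv 0); first by rewrite rx.
  have nSx : ~ S 0 x by move/special_lt_rank; rewrite rx.
  have nSy : ~ S 0 y by move/special_lt_rank; rewrite ry rx.
  have [z Sz] := class_inh (split_S hs 0).
  have other P Q : bclasses phi 0 P -> bclasses phi 0 Q ->
      (forall u, P u \/ Q u) -> P z -> E 0 x y.
    move=> hP hQ PQ Pz.
    have SP : S 0 = P by rewrite (bclasses_eq hP Pz) (bclasses_eq (split_S hs 0) Sz).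
    rewrite SP in nSx nSy.
    case: (PQ x) (PQ y) => [//|Qx] [//|Qy]; exact: class_equiv Qx Qy.
  case: (split_AB0 hs z); first exact: other (split_A hs 0) (split_B hs 0) (split_AB0 hs).
  apply: other (split_B hs 0) (split_A hs 0) _.
  by move=> u; case: (split_AB0 hs u); [right|left].
move=> /prednK; move: (rank x).-1 => n /esym rx; rewrite rx => /esym ry.
have Sx := rank_special rx; have Sy := rank_special ry.
case: (pselect (E n.+1 x y)) => [|nxy]; first by apply: rank_le_equiv; rewrite rx.
case: (@special_not_few _ _ _ _ _ _ _ hs n).
exists [:: x; y] => z Sz.
have sub u : rank u = n.+1 -> E n.+1 u z -> equiv_all phi z u.
  by move=> ru uz; apply: equiv_all_sym; apply: rank_le_equiv uz; rewrite ru.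
case: (pselect (E n.+1 x z)) => [xz|nxz].
  by exists x; [rewrite mem_head|exact: sub].
exists y; first by rewrite !inE eqxx orbT.
apply: sub => //.
have hA := class_equiv (split_A hs n.+1); have hB := class_equiv (split_B hs n.+1).
move: Sx Sy Sz => /(split_SAB hs)[] ? /(split_SAB hs)[] ? /(split_SAB hs)[] ?;
  by [exact: hA|exact: hB|case: nxy; exact: hA|case: nxy; exact: hB
     |case: nxz; exact: hA|case: nxz; exact: hB].
Qed.

(** The rank grows by at most one along an edge, and vertices of [S n] have rank above [n], so a
    path from [x] to [S n] passes through rank [n]. *)
Lemma rank_surj x n : rank x <= n -> exists y, rank y = n.
Proof.
move=> xn; have [z Sz] := class_inh (split_S hs n).
have zn := ltnW (special_lt_rank Sz).
have [p xp pz] := tree_connected x z; rewrite -{}pz {z Sz} in zn.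
elim: p x xn xp zn => [|y p IH] x xn /=.
  by move=> _ nx; exists x; apply/eqP; rewrite eqn_leq xn.
move=> /andP[xy yp] zn; move: xn; rewrite leq_eqVlt => /orP[/eqP|xn].
  by exists x.
by apply: (IH y) => //; apply: leq_trans xn; exact: rank_adj.
Qed.

(** A neighbor inequivalent to [x] has the rank of [x] plus or minus one, and the rank determines
    the equivalence class. *)
Lemma rank_linear : linear.
Proof.
move=> n x y1 y2 y3 x1 x2 x3.
have nE u v : ~ E n u v -> rank u <> rank v by move=> nuv /rank_equiv /(_ n).
move=> /nE n1 /nE n2 /nE n3 /nE n12 /nE n13 /nE n23.
have h v : adj x v -> rank x <> rank v ->
    rank v = (rank x).+1 \/ rank x = (rank v).+1.
  move=> xv xnv; have := rank_adj xv.
  rewrite leq_eqVlt => /orP[/eqP|]; first by left.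
  rewrite ltnS leq_eqVlt => /orP[/eqP/esym//|vx]; right.
  by apply/eqP; rewrite eqn_leq vx andbT; apply: rank_adj; rewrite adjC.
case: (h y1 x1 n1) (h y2 x2 n2) (h y3 x3 n3) => h1 [] h2 [] h3; congruence.
Qed.

End Rank.

(** * The degree bound, whether ranks are finite or not *)

Section Dichotomy.
Variables (d : nat) (T : regular_tree d) (phi : T -> bool).
Variables S A B C : nat -> set T.
Hypothesis hs : splitting phi S A B C.

Lemma settled_all x t : settled S t x -> forall y, exists t', settled S t' y.
Proof.
move=> tx; apply: (@tree_connect _ _ _ x); first by exists t.
by move=> u v [s su] uv; exists s.+1; exact: (settled_adj hs su uv).
Qed.

Lemma sturmian_linear : linear phi.
Proof.
case: (pselect (exists x t, settled S t x)) => [[x [t tx]]|nex].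
  exact: rank_linear hs (settled_all tx).
move=> n x y1 y2 y3; apply: (unsettled_degree hs) => t tx.
by apply: nex; exists x, t.
Qed.

End Dichotomy.

(** * Cycles *)


Section CycleSeq.
Variables (U : eqType) (e : rel U).
Implicit Types (X Y Z D F W : U) (q : seq U).

Lemma cycle_rot_to (c : seq U) X : 2 < size c -> uniq c -> cycle e c -> X \in c ->
  exists D q F, [/\ path e D (rcons q F), e X D, e F X,
    uniq (X :: D :: rcons q F) & c =i X :: D :: rcons q F].
Proof.
move=> c2 uc ec Xc; have [i p def] := rot_to Xc.
move: c2 uc ec; rewrite -(size_rot i) -(rot_uniq i) -(rot_cycle i) def.
case: p def => // D p; case: (lastP p) => // q F def _ uc.
rewrite /= rcons_path last_rcons => /and3P[XD Dq FX].
by exists D, q, F; split=> // Z; rewrite -(mem_rot i) def.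
Qed.

Lemma uniq_cycle_neq X D q F : uniq (X :: D :: rcons q F) ->
  [/\ D <> X, F <> X & D <> F].
Proof.
rewrite /= !inE !mem_rcons !inE !negb_or.
move=> /andP[/and3P[/eqP XD /eqP XF _] /andP[/andP[/eqP DF _] _]].
by split=> //; exact: nesym.
Qed.

Lemma uniq_cycle_next X D q F : uniq (X :: D :: rcons q F) ->
  path e D (rcons q F) ->
  exists Y, [/\ e D Y, Y <> X, Y <> D & Y \in rcons q F].
Proof.
case: q => [|Y q] /=; rewrite !inE !negb_or.
  move=> /andP[/andP[/eqP XD /eqP XF] /andP[/eqP DF _]] /andP[DY _].
  by exists F; split=> //; rewrite ?mem_head //; exact: nesym.
move=> /andP[/and3P[_ /eqP XY _] /andP[/andP[/eqP DY' _] _]] /andP[DY _].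
by exists Y; split=> //; rewrite ?mem_head //; exact: nesym.
Qed.

(** For [Z] not next to [X], the neighbors of [Z] on the cycle differ from [X]; a chord from [X] to
    [Z] then gives [Z] a third neighbor. *)
Lemma uniq_cycle_inner X D q F Z : uniq (X :: D :: rcons q F) ->
  path e D (rcons q F) -> Z \in q ->
  exists Y W, [/\ e Y Z, e Z W & uniq [:: X; Y; Z; W]].
Proof.
move=> uS Dq Zq; case/splitPr: Zq Dq uS => q1 q2.
rewrite rcons_cat rcons_cons cat_path => /= /and3P[_ YZ Zq] uS.
have [W ZW Wq] : exists2 W, e Z W & W \in rcons q2 F.
  case: q2 {uS} Zq => [|W q2] /= /andP[ZW _]; first by exists F; rewrite ?inE.
  by exists W; rewrite ?inE ?eqxx.
exists (last D q1), W; split=> //.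
have YDq : last D q1 \in D :: q1 by exact: mem_last.
have {}uS : uniq (X :: (D :: q1) ++ Z :: rcons q2 F) by [].
move: uS; rewrite cons_uniq cat_uniq => /and4P[XnS _ /hasPn h /andP[Zn _]].
have nX V : V \in (D :: q1) ++ Z :: rcons q2 F -> X != V.
  by move=> Vc; apply/eqP => XV; rewrite XV Vc in XnS.
have nY V : V \in Z :: rcons q2 F -> last D q1 != V.
  by move=> /h Vn; apply/eqP => YV; rewrite /= -YV YDq in Vn.
have ZW' : Z != W by apply/eqP => e'; rewrite e' Wq in Zn.
rewrite /= !inE !negb_or ZW' !nY ?mem_head ?inE ?Wq ?orbT //=.
by rewrite !nX // mem_cat ?YDq // ?mem_head ?inE ?Wq ?orbT.
Qed.

End CycleSeq.

(** * Cycles of the graphs of balls and their lifts *)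

Section Cycles.
Variables (d : nat) (T : regular_tree d) (phi : T -> bool).
Implicit Types (x y z u v w : T) (n k : nat) (X Y Z D F : set T).

Local Notation E := (ball_equiv phi).
Local Notation cl := (bclass phi).
Local Notation bedge n := (fun D F : set T => `[< ball_edge phi n D F >]).

Lemma ball_edgeP n D F : ball_edge phi n D F <->
  [/\ bclasses phi n D, bclasses phi n F & exists x y, [/\ adj x y, D x & F y]].
Proof.
split=> [[x [y [xy <- <-]]]|[nD nF [x [y [xy Dx Fy]]]]].
  split; [by exists x|by exists y|exists x, y; split=> //; exact: bclass_self].
by exists x, y; rewrite -(bclasses_eq nD Dx) -(bclasses_eq nF Fy).
Qed.

Lemma ball_edge_sym n D F : ball_edge phi n D F -> ball_edge phi n F D.
Proof. by move=> [x [y [xy xD yF]]]; exists y, x; rewrite adjC. Qed.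

Lemma classes_disjoint n D F x : bclasses phi n D -> bclasses phi n F ->
  D x -> F x -> D = F.
Proof. by move=> nD nF Dx Fx; rewrite (bclasses_eq nD Dx) (bclasses_eq nF Fx). Qed.

Definition touches x D := exists2 y, D y & adj x y.

Hypothesis hl : linear phi.

Lemma linear_touches n x D1 D2 D3 :
  bclasses phi n D1 -> bclasses phi n D2 -> bclasses phi n D3 ->
  D1 <> D2 -> D1 <> D3 -> D2 <> D3 -> ~ D1 x -> ~ D2 x -> ~ D3 x ->
  touches x D1 -> touches x D2 -> touches x D3 -> False.
Proof.
move=> n1 n2 n3 d12 d13 d23 x1 x2 x3 [y1 Dy1 xy1] [y2 Dy2 xy2] [y3 Dy3 xy3].
have nE D F u v : bclasses phi n D -> bclasses phi n F -> D <> F -> D u -> F v ->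
    ~ E n u v.
  move=> nD nF DF Du Fv uv; apply: DF; apply: (classes_disjoint nD nF _ Fv).
  exact: (class_closed nD Du uv).
have nEx D u : bclasses phi n D -> ~ D x -> D u -> ~ E n x u.
  by move=> nD Dx Du /ball_equiv_sym xu; apply: Dx; exact: (class_closed nD Du xu).
exact: (hl xy1 xy2 xy3 (nEx _ _ n1 x1 Dy1) (nEx _ _ n2 x2 Dy2)
  (nEx _ _ n3 x3 Dy3) (nE _ _ _ _ n1 n2 d12 Dy1 Dy2)
  (nE _ _ _ _ n1 n3 d13 Dy1 Dy3) (nE _ _ _ _ n2 n3 d23 Dy2 Dy3)).
Qed.

Variables S A B C : nat -> set T.
Hypothesis hs : splitting phi S A B C.

Lemma subAS n : A n.+1 `<=` S n.
Proof. by move=> x Ax; apply/(split_SAB hs); left. Qed.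

Lemma subBS n : B n.+1 `<=` S n.
Proof. by move=> x Bx; apply/(split_SAB hs); right. Qed.

Lemma neqAB n : A n <> B n.
Proof.
move=> AB; have [x Ax] := class_inh (split_A hs n).
by apply: (split_AB hs Ax); rewrite -AB.
Qed.

(** Classes are sets of centers, so the unique extension of a nonspecial class is the very same
    set. *)
Lemma class_eqS n x : ~ S n x -> cl n.+1 x = cl n x.
Proof.
move=> nS; apply/seteqP; split=> y; first exact: ball_equivS.
exact: (split_stable hs nS).
Qed.

Lemma nonspecial n D x : bclasses phi n D -> D <> S n -> D x -> ~ S n x.
Proof. by move=> nD DS Dx Sx; apply: DS; exact: classes_disjoint nD (split_S hs n) Dx Sx. Qed.

Lemma class_up n D : bclasses phi n D -> D <> S n -> bclasses phi n.+1 D.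
Proof.
move=> nD DS; have [x Dx] := class_inh nD.
rewrite (bclasses_eq nD Dx) -class_eqS; first by exists x.
exact: nonspecial Dx.
Qed.

Lemma class_down n D : bclasses phi n.+1 D -> D <> A n.+1 -> D <> B n.+1 ->
  bclasses phi n D /\ D <> S n.
Proof.
move=> nD DA DB; have [x Dx] := class_inh nD.
have nSx : ~ S n x.
  move=> /(split_SAB hs)[Ax|Bx].
    by apply: DA; exact: classes_disjoint nD (split_A hs _) Dx Ax.
  by apply: DB; exact: classes_disjoint nD (split_B hs _) Dx Bx.
split; last by move=> DS; apply: nSx; rewrite -DS.
by rewrite (bclasses_eq nD Dx) class_eqS //; exists x.
Qed.

(** Outside of [S n] the [n]-ball determines the [n.+1]-ball, hence the classes of the neighbors. *)
Lemma edge_touches n D F x : ball_edge phi n D F -> D <> S n -> D x -> touches x F.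
Proof.
move=> /ball_edgeP[nD nF [u [v [uv Du Fv]]]] DS Dx.
have ux := split_stable hs (nonspecial nD DS Du) (class_equiv nD Du Dx).
have [w xw vw] := ball_equiv_adj ux uv.
by exists w => //; exact: class_closed vw.
Qed.

(* Up to the choice between A and B, all vertices of the special class have
   the same neighbors. *)
Lemma special_touches n F x : ball_edge phi n (S n) F -> F <> A n -> F <> B n ->
  S n x -> touches x F.
Proof.
move=> /ball_edgeP[_ nF [u [v [uv Su Fv]]]] FA FB Sx.
have ux := class_equiv (split_S hs n) Su Sx.
have nA : ~ A n v by move=> Av; apply: FA; exact: classes_disjoint nF (split_A hs n) Fv Av.
have nB : ~ B n v by move=> Bv; apply: FB; exact: classes_disjoint nF (split_B hs n) Fv Bv.
case: n => [|n] in nF Su FA FB Sx ux nA nB *; first by case: (split_AB0 hs v).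
have nS : ~ S n v by move/(split_SAB hs) => [].
have [w xw vw] := ball_equiv_adj ux uv; exists w => //.
by apply: class_closed nF Fv _; exact: (split_stable hs nS vw).
Qed.

Lemma edge_up n D F : ball_edge phi n D F -> D <> S n -> F <> S n ->
  ball_edge phi n.+1 D F.
Proof.
move=> /ball_edgeP[nD nF DF] DS FS; apply/ball_edgeP.
by split=> //; exact: class_up.
Qed.

(* Otherwise the vertices of D would meet A (n + 1), B (n + 1) and X. *)
Lemma next_special n D X : ball_edge phi n (S n) D -> D <> S n ->
  D <> A n -> D <> B n -> ball_edge phi n D X -> X <> S n -> X <> D ->
  S n.+1 = D.
Proof.
move=> SD DS DA DB DX XS XD; apply: contrapT => SnD.
have /ball_edgeP[_ nD _] := SD; have /ball_edgeP[_ nX _] := DX.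
have [x Dx] := class_inh nD.
have nD1 := class_up nD DS; have nX1 := class_up nX XS.
have touchesS P : bclasses phi n.+1 P -> P `<=` S n -> touches x P /\ P <> X /\ ~ P x.
  move=> nP PS; have [p Pp] := class_inh nP.
  have [y Dy py] := special_touches SD DA DB (PS _ Pp).
  have DP : ball_edge phi n.+1 D P.
    by apply/ball_edgeP; split=> //; exists y, p; rewrite adjC.
  split; first by apply: (edge_touches DP) Dx; exact: nesym.
  split; first by move=> PX; apply: (nonspecial nX XS _ (PS _ Pp)); rewrite -PX.
  by move=> /PS; exact: nonspecial Dx.
have [mA [AX nAx]] := touchesS _ (split_A hs n.+1) (@subAS n).
have [mB [BX nBx]] := touchesS _ (split_B hs n.+1) (@subBS n).
apply: (linear_touches (split_A hs n.+1) (split_B hs n.+1) nX1 _ AX BX nAx nBx _ mA mB).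
- exact: neqAB.
- by move=> Xx; apply: XD; exact: classes_disjoint nX nD Xx Dx.
- exact: (edge_touches DX DS Dx).
Qed.

(** A cycle through [X] with its two neighbors [D] and [F] on the cycle displayed; [q] is empty for
    a cycle of length three. *)
Definition ncycle n X D (q : seq (set T)) F :=
  [/\ path (bedge n) D (rcons q F), ball_edge phi n X D, ball_edge phi n F X &
      uniq (X :: D :: rcons q F)].

Lemma ball_cycle_ncycle n c X : ball_cycle phi n c -> X \in c ->
  exists D q F, ncycle n X D q F /\ c =i X :: D :: rcons q F.
Proof.
move=> [c2 uc ec] Xc; have [D [q [F [Dq /asboolP XD /asboolP FX uX cX]]]] :=
  cycle_rot_to c2 uc ec Xc.
by exists D, q, F.
Qed.

Lemma ncycle_ball_cycle n X D q F : ncycle n X D q F ->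
  ball_cycle phi n (X :: D :: rcons q F).
Proof.
move=> [Dq XD FX uX]; split=> //; first by rewrite /= size_rcons.
rewrite /= rcons_path last_rcons; apply/andP; split; first exact/asboolP.
by apply/andP; split=> //; apply/asboolP.
Qed.

Lemma ncycle_rev n X D q F : ncycle n X D q F -> ncycle n X F (rev q) D.
Proof.
move=> [Dq XD FX uX]; split.
- have := rev_path (bedge n) D (rcons q F).
  rewrite last_rcons belast_rcons rev_cons => ->.
  by apply: sub_path Dq => Y Z /asboolP YZ; apply/asboolP; exact: ball_edge_sym.
- exact: ball_edge_sym.
- exact: ball_edge_sym.
- rewrite (perm_uniq (s2 := X :: D :: rcons q F)) //.
  by rewrite perm_cons -rev_cons -rev_rcons rcons_cons perm_rev.
Qed.

Lemma mem_ncycle_rev X D q F :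
  X :: F :: rcons (rev q) D =i X :: D :: rcons q F.
Proof.
move=> Z; rewrite !inE !mem_rcons !inE mem_rev.
by case: (Z == X); case: (Z == D); case: (Z == F); case: (Z \in q).
Qed.

Lemma ball_cycle_class n c X : ball_cycle phi n c -> X \in c -> bclasses phi n X.
Proof.
move=> hc Xc; have [D [q [F [[_ /ball_edgeP[] //]]]]] := ball_cycle_ncycle hc Xc.
Qed.

Lemma ncycle_class n X D q F Z : ncycle n X D q F -> Z \in X :: D :: rcons q F ->
  bclasses phi n Z.
Proof. by move=> /ncycle_ball_cycle; exact: ball_cycle_class. Qed.

Lemma ncycle_next n X D q F : ncycle n X D q F ->
  exists Y, [/\ ball_edge phi n D Y, Y <> X, Y <> D & Y \in rcons q F].
Proof.
move=> [Dq _ _ uX]; have [Y [/asboolP DY YX YD Yq]] := uniq_cycle_next uX Dq.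
by exists Y.
Qed.

Lemma ncycle_neq n X D q F : ncycle n X D q F -> [/\ D <> X, F <> X & D <> F].
Proof. by move=> [_ _ _]; exact: uniq_cycle_neq. Qed.

(** If [S n] is off the cycle, a vertex with class on the cycle touches both adjacent classes of the
    cycle. The degree bound then keeps the classes of all its neighbors on the cycle, and by
    connectedness every class is on it, [S n] included. *)
Lemma special_on_cycle n c : ball_cycle phi n c -> S n \in c.
Proof.
move=> hc; apply: contrapT => /negP nSc.
have [X Xc] : exists X, X \in c.
  by case: hc; case: c {nSc} => // X c; exists X; rewrite mem_head.
have [x Xx] := class_inh (ball_cycle_class hc Xc).
have xc : cl n x \in c by rewrite -(bclasses_eq (ball_cycle_class hc Xc) Xx).
have [s Ss] := class_inh (split_S hs n).
suff : cl n s \in c by rewrite -(bclasses_eq (split_S hs n) Ss) (negbTE nSc).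
move: s {Ss}; apply: (tree_connect xc) => u v uc uv; apply: contrapT => /negP vc.
have [D [q [F [hn cE]]]] := ball_cycle_ncycle hc uc.
have [DX FX DF] := ncycle_neq hn; have [_ uD Fu _] := hn.
have inc Z : Z \in cl n u :: D :: rcons q F -> Z <> cl n v.
  by rewrite -cE => Zc Zv; rewrite Zv (negbTE vc) in Zc.
have nSu : cl n u <> S n by move=> uS; rewrite uS (negbTE nSc) in uc.
have cv : bclasses phi n (cl n v) by exists v.
have cu : bclasses phi n (cl n u) by exists u.
have uu := bclass_self phi n u.
have Dc : D \in cl n u :: D :: rcons q F by rewrite !inE eqxx orbT.
have Fc : F \in cl n u :: D :: rcons q F by rewrite !inE mem_rcons inE eqxx !orbT.
have nu Z : bclasses phi n Z -> Z <> cl n u -> ~ Z u.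
  by move=> nZ Zu Zuu; apply: Zu; exact: classes_disjoint nZ cu Zuu uu.
apply: (linear_touches (ncycle_class hn Dc) (ncycle_class hn Fc) cv DF
  (inc _ Dc) (inc _ Fc)).
- exact: nu (ncycle_class hn Dc) DX.
- exact: nu (ncycle_class hn Fc) FX.
- by apply: nu cv _; apply: nesym; apply: inc; rewrite mem_head.
- exact: (edge_touches uD nSu uu).
- exact: (edge_touches (ball_edge_sym Fu) nSu uu).
- by exists v => //; exact: bclass_self.
Qed.

(** If [Z] were in [q], its vertices would touch [S n] besides the two classes adjacent to [Z] on
    the cycle. *)
Lemma special_no_chord n D q F Z : ncycle n (S n) D q F ->
  ball_edge phi n (S n) Z -> Z \in rcons q F -> Z = F.
Proof.
move=> hn SZ; rewrite mem_rcons inE => /orP[/eqP //|Zq]; exfalso.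
have [Dq _ _ uS] := hn.
have [Y [W [/asboolP YZ /asboolP ZW]]] := uniq_cycle_inner uS Dq Zq.
have /ball_edgeP[nZ nW _] := ZW; have /ball_edgeP[nY _ _] := YZ.
move=> uYZW; have [YS WS YW] := @uniq_cycle_neq _ _ _ [:: Z] _ uYZW.
have [/nesym YZ' WY WZ] : [/\ Z <> Y, W <> Y & Z <> W].
  by case/andP: uYZW => _; exact: (@uniq_cycle_neq _ _ _ [::]).
have ZS : Z <> S n.
  by move=> ZS; case/andP: uYZW; rewrite -ZS !inE eqxx orbT.
have {}WZ := nesym WZ.
have [x Zx] := class_inh nZ.
have dis V : bclasses phi n V -> V <> Z -> ~ V x.
  by move=> nV VZ Vx; apply: VZ; exact: classes_disjoint nV nZ Vx Zx.
apply: (linear_touches nY nW (split_S hs n) YW YS WS (dis _ nY YZ') (dis _ nW WZ)).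
- by apply: dis (split_S hs n) _; exact: nesym.
- exact: (edge_touches (ball_edge_sym YZ) ZS Zx).
- exact: (edge_touches ZW ZS Zx).
- exact: (edge_touches (ball_edge_sym SZ) ZS Zx).
Qed.

Lemma path_up n D q F : path (bedge n) D (rcons q F) ->
  S n \notin D :: rcons q F -> path (bedge n.+1) D (rcons q F).
Proof.
move=> Dq Sn; apply: (sub_in_path (P := [pred X | X != S n]) _ _ Dq).
  move=> X Y; rewrite !inE => /eqP XS /eqP YS XY.
  exact: edge_up XY XS YS.
by apply/allP => X Xc; rewrite inE; apply/eqP => XS; rewrite -XS Xc in Sn.
Qed.

Lemma split_notin n W D q F : ncycle n (S n) D q F -> bclasses phi n.+1 W ->
  W `<=` S n -> W \notin D :: rcons q F.
Proof.
move=> hn nW WS; apply/negP => Wc; have [w Ww] := class_inh nW.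
have WSn : W = S n.
  apply: (classes_disjoint _ (split_S hs n) Ww (WS _ Ww)).
  by apply: ncycle_class hn _; rewrite inE Wc orbT.
by have [_ _ _ /andP[]] := hn; rewrite -WSn Wc.
Qed.

(* The special class is replaced by one of its two parts. *)
Lemma ncycle_up n W D q F : ncycle n (S n) D q F ->
  bclasses phi n.+1 W -> W `<=` S n ->
  ball_edge phi n.+1 W D -> ball_edge phi n.+1 F W -> ncycle n.+1 W D q F.
Proof.
move=> hn nW WS WD FW; have [Dq _ _ /= /andP[Sn uD]] := hn.
split=> //; first exact: path_up.
by rewrite /= (split_notin hn nW WS).
Qed.

(* U records that the union of the cycle does not increase with n, so that the
   special class never comes back to B n. *)
Definition detached n (U : set T) := exists c,
  [/\ ball_cycle phi n c, S n \in c, B n \notin c & forall Z, Z \in c -> Z `<=` U].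

(** A vertex of [B n.+1] touches [B n]; if neither neighbor of [S n] on the cycle were [A n], it
    would touch both of them too. Reversing the cycle puts [A n] last. *)
Lemma detached_ncycle n c : ball_cycle phi n c -> B n \notin c ->
  exists D q, ncycle n (S n) D q (A n) /\ c =i S n :: D :: rcons q (A n).
Proof.
move=> hc Bc; have [D [q [F [hn cE]]]] := ball_cycle_ncycle hc (special_on_cycle hc).
rewrite cE in Bc.
case: (pselect (F = A n)) => [<-|FA]; first by exists D, q.
case: (pselect (D = A n)) => [<-|DA].
  exists F, (rev q); split; first exact: ncycle_rev.
  by move=> Z; rewrite cE mem_ncycle_rev.
exfalso; have [b Bb] := class_inh (split_B hs n.+1); have Sb := subBS Bb.
have [_ SD FS _] := hn; have {}FS := ball_edge_sym FS.
have [DS FSn DF] := ncycle_neq hn.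
have nB Z : Z \in S n :: D :: rcons q F -> Z <> B n.
  by move=> Zc ZB; rewrite -ZB Zc in Bc.
have Dc : D \in S n :: D :: rcons q F by rewrite !inE eqxx orbT.
have Fc : F \in S n :: D :: rcons q F by rewrite !inE mem_rcons inE eqxx !orbT.
have nS Z : bclasses phi n Z -> Z <> S n -> ~ Z b.
  by move=> nZ ZS Zb; apply: ZS; exact: classes_disjoint nZ (split_S hs n) Zb Sb.
have nD := ncycle_class hn Dc; have nF := ncycle_class hn Fc.
apply: (linear_touches nD nF (split_B hs n) DF (nB _ Dc) (nB _ Fc)).
- exact: nS nD DS.
- exact: nS nF FSn.
- by apply: nS (split_B hs n) _; apply: nesym; apply: nB; rewrite mem_head.
- by apply: special_touches Sb => //; exact: nB.
- by apply: special_touches Sb => //; exact: nB.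
- exact: (split_BB hs Bb).
Qed.

(** Vertices of [A n.+1] still touch [D], by [special_touches], and [A n], by the naming, so
    [A n.+1] takes the place of [S n]. *)
Lemma ncycle_up_next n D q : ncycle n (S n) D q (A n) -> D <> B n ->
  S n.+1 = D /\ ncycle n.+1 (A n.+1) D q (A n).
Proof.
move=> hn DB; have [DS AS DA] := ncycle_neq hn; have [_ SD _ _] := hn.
split.
  have [Y [DY YS YD _]] := ncycle_next hn.
  exact: (next_special SD DS DA DB DY YS YD).
have [x Ax] := class_inh (split_A hs n.+1).
apply: ncycle_up hn (split_A hs _) (@subAS n) _ _; apply/ball_edgeP.
  split; [exact: (split_A hs)| |].
    by apply: class_up => //; have /ball_edgeP[] := SD.
  by have [y Dy xy] := special_touches SD DA DB (subAS Ax); exists x, y.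
split; [|exact: (split_A hs)|].
  exact: class_up (split_A hs n) AS.
by have [y Ay xy] := split_AA hs Ax; exists y, x; rewrite adjC.
Qed.

Lemma detached_next n c : ball_cycle phi n c -> B n \notin c ->
  exists D q, [/\ ncycle n (S n) D q (A n), c =i S n :: D :: rcons q (A n),
    S n.+1 = D & ncycle n.+1 (A n.+1) D q (A n)].
Proof.
move=> hc Bc; have [D [q [hn cE]]] := detached_ncycle hc Bc.
have [|SD hn1] := ncycle_up_next hn; last by exists D, q.
by move=> DB; move: Bc; rewrite cE -DB !inE eqxx orbT.
Qed.

Lemma detachedS n U : detached n U -> detached n.+1 U.
Proof.
move=> [c [hc Sc Bc cU]]; have [D [q [hn cE SD hn1]]] := detached_next hc Bc.
exists (A n.+1 :: D :: rcons q (A n)); split.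
- exact: ncycle_ball_cycle.
- by rewrite SD !inE eqxx orbT.
- rewrite inE negb_or (split_notin hn (split_B hs _) (@subBS n)) andbT.
  by apply/eqP => BA; exact: (@neqAB n.+1).
- move=> Z; rewrite inE => /orP[/eqP->|Zc]; last by apply: cU; rewrite cE inE Zc orbT.
  by move=> z /subAS; apply: cU; rewrite cE mem_head.
Qed.

Lemma detached_le n m U : n <= m -> detached n U -> detached m U.
Proof.
by move=> /subnK <-; elim: (m - n) => //= k IH /IH; exact: detachedS.
Qed.

Lemma detached_settled n U x : detached n U -> B n x -> settled S n x.
Proof.
move=> [c [hc Sc Bc cU]] Bx m nm Sx.
(* The bound is now the union of the cycle itself, which is disjoint from [B n]. *)
have : detached n [set y | exists2 Z, Z \in c & Z y].
  by exists c; split=> // Z Zc z Zz; exists Z.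
move=> /(detached_le nm) [c' [_ Sc' _ /(_ _ Sc' _ Sx)]] [Z Zc Zx].
have ZB := classes_disjoint (ball_cycle_class hc Zc) (split_B hs n) Zx Bx.
by rewrite -ZB Zc in Bc.
Qed.

Lemma specialS_center n : S n.+1 <> A n.+1 -> S n.+1 <> B n.+1 ->
  S n.+1 = C n /\ S n.+1 <> S n.
Proof.
move=> SA SB; have [nS nSS] := class_down (split_S hs _) SA SB; split=> //.
have [x Sx] := class_inh (split_S hs n.+1).
exact: classes_disjoint nS (split_C hs n) Sx (split_SC hs Sx).
Qed.

(** The next special class is the neighbor [D] of [S n] on the cycle; as a class of [n]-balls
    containing [S n.+1], it is [C n]. *)
Lemma detached_S_C n U : detached n U -> S_C_on_cycle phi S C n.
Proof.
move=> [c [hc Sc Bc cU]]; have [D [q [hn cE SD hn1]]] := detached_next hc Bc.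
have [DS _ _] := ncycle_neq hn.
have DC : D = C n.
  have [x Sx] := class_inh (split_S hs n.+1).
  have /ball_edgeP[_ nD _] : ball_edge phi n (S n) D by case: hn.
  apply: (classes_disjoint nD (split_C hs n) _ (split_SC hs Sx)).
  by rewrite -SD.
split; first by rewrite -DC; exact: nesym.
by exists c; split=> //; rewrite cE -DC !inE eqxx orbT.
Qed.

(* Going back from n + 1 to n, A (n + 1) becomes the special class. *)
Lemma detachedS_S_C n U : detached n.+1 U -> S_C_on_cycle phi S C n.
Proof.
move=> [c [hc Sc Bc cU]]; have [D [q [hn cE]]] := detached_ncycle hc Bc.
have [_ AS _] := ncycle_neq hn; have [Dq SD A1S uS] := hn.
(* Apart from [A n.+1], the classes of the cycle are already classes of [n]-balls other than
   [S n]. *)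
have down Z : Z \in S n.+1 :: D :: q -> bclasses phi n Z /\ Z <> S n.
  move=> Zc; have Zc' : Z \in S n.+1 :: D :: rcons q (A n.+1).
    by rewrite -rcons_cons -rcons_cons mem_rcons inE Zc orbT.
  apply: class_down; first exact: ncycle_class hn Zc'.
    move: uS; rewrite -rcons_cons -rcons_cons rcons_uniq => /andP[/negP nA _] ZA.
    by apply: nA; rewrite -ZA.
  by move=> ZB; rewrite cE -ZB Zc' in Bc.
have edown X Y : ball_edge phi n.+1 X Y -> X \in S n.+1 :: D :: q ->
    Y \in S n.+1 :: D :: q -> ball_edge phi n X Y.
  move=> /ball_edgeP[_ _ XY] /down[nX _] /down[nY _].
  by apply/ball_edgeP.
have eA X : ball_edge phi n.+1 X (A n.+1) -> X \in S n.+1 :: D :: q ->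
    ball_edge phi n X (S n).
  move=> /ball_edgeP[_ _ [x [y [xy Xx Ay]]]] /down[nX _].
  apply/ball_edgeP; split=> //; first exact: (split_S hs).
  by exists x, y; split=> //; exact: subAS.
have [S1 Sn1] : S n.+1 = C n /\ S n.+1 <> S n.
  apply: specialS_center; first exact: nesym.
  by move=> SB; rewrite -SB Sc in Bc.
have hn' : ncycle n (S n.+1) D q (S n).
  split.
  - move: Dq; rewrite !rcons_path => /andP[Dq /asboolP qA].
    apply/andP; split; last first.
      by apply/asboolP; apply: eA => //; rewrite inE mem_last orbT.
    apply: (sub_in_path (P := [in D :: q]) _ _ Dq); last exact/allP.
    move=> X Y Xc Yc /asboolP XY; apply/asboolP; apply: edown => //.
      by rewrite inE -[X \in D :: q]/(X \in [in D :: q]) Xc orbT.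
    by rewrite inE -[Y \in D :: q]/(Y \in [in D :: q]) Yc orbT.
  - by apply: edown => //; rewrite !inE eqxx ?orbT.
  - apply: ball_edge_sym; apply: eA; last by rewrite mem_head.
    exact: ball_edge_sym.
  - move: uS; rewrite -!rcons_cons !rcons_uniq => /andP[_ ->]; rewrite andbT.
    by apply/negP => /down[].
split; first by rewrite -S1; exact: nesym.
exists (S n.+1 :: D :: rcons q (S n)); split; first exact: ncycle_ball_cycle.
  by rewrite !inE mem_rcons inE eqxx !orbT.
by rewrite -S1 mem_head.
Qed.

End Cycles.

(** * From cycles to detached classes *)


Section Detachment.
Variables (d : nat) (T : regular_tree d) (phi : T -> bool).
Hypothesis hl : linear phi.
Implicit Types (x y z u v w : T) (n k : nat) (X Y Z D F : set T).

(** The parts of [S n] give it edges to [A n] and to [B n]; as [S n] has no chords, these are its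
    two neighbors on the cycle. *)
Lemma ncycle_both S A B C (hs : splitting phi S A B C) n c : ball_cycle phi n c ->
  A n \in c -> B n \in c -> S n <> A n -> S n <> B n ->
  exists q, ncycle phi n (S n) (A n) q (B n) /\ c =i S n :: A n :: rcons q (B n).
Proof.
move=> hc Ac Bc SA SB.
have [D [q [F [hn cE]]]] := ball_cycle_ncycle hc (special_on_cycle hl hs hc).
have inDF Z : ball_edge phi n (S n) Z -> Z \in c -> S n <> Z -> Z = D \/ Z = F.
  move=> SZ; rewrite cE inE => /orP[/eqP-> //|]; rewrite inE => /orP[/eqP ZD|Zq] _.
    by left.
  by right; exact: (special_no_chord hl hs hn).
have edge Y Z : bclasses phi n Z -> Y `<=` S n -> (exists x, Y x) ->
    always_adjacent Y Z -> ball_edge phi n (S n) Z.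
  move=> nZ YS [y Yy] /(_ y Yy)[z Zz yz]; apply/ball_edgeP.
  by split=> //; [exact: (split_S hs)|exists y, z; split=> //; exact: YS].
have SeA : ball_edge phi n (S n) (A n).
  apply: edge (split_A hs n) (@subAS _ _ _ _ _ _ _ hs n) _ (@split_AA _ _ _ _ _ _ _ hs n).
  exact: class_inh (split_A hs n.+1).
have SeB : ball_edge phi n (S n) (B n).
  apply: edge (split_B hs n) (@subBS _ _ _ _ _ _ _ hs n) _ (@split_BB _ _ _ _ _ _ _ hs n).
  exact: class_inh (split_B hs n.+1).
have AB := @neqAB _ _ _ _ _ _ _ hs n.
case: (inDF _ SeA Ac SA) (inDF _ SeB Bc SB) => eA [] eB.
- by case: AB; rewrite eA.
- by rewrite eA eB; exists q.
- rewrite eA eB; exists (rev q); split; first exact: ncycle_rev.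
  by move=> Z; rewrite cE mem_ncycle_rev.
- by case: AB; rewrite eA.
Qed.

Lemma ncycle_detachedA S A B C (hs : splitting phi S A B C) n D q F :
  ncycle phi n (S n) D q F -> ncycle phi n.+1 (B n.+1) D q F -> S n.+1 = D ->
  detached phi S A n.+1 setT.
Proof.
move=> hn hn1 SD; exists (B n.+1 :: D :: rcons q F); split=> //.
- exact: ncycle_ball_cycle.
- by rewrite SD !inE eqxx orbT.
- rewrite inE negb_or (split_notin hs hn (split_A hs _) (@subAS _ _ _ _ _ _ _ hs n)).
  by rewrite andbT; apply/eqP; exact: (@neqAB _ _ _ _ _ _ _ hs n.+1).
Qed.

(** The edge from [S n] to [B n] is not a chord, so [B n] is next to [S n] on the cycle, and the
    neighbor on the other side is not [A n], which is [S n]. Thus [ncycle_up_next] applies with [A]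
    and [B] exchanged. *)
Lemma cycle_special_A S A B C (hs : splitting phi S A B C) n c :
  ball_cycle phi n c -> S n = A n -> B n \in c -> detached phi S A n.+1 setT.
Proof.
move=> hc SA Bc; have hs' := splitting_sym hs.
have AB := @neqAB _ _ _ _ _ _ _ hs n.
have [D [q [hn DA]]] : exists D q, ncycle phi n (S n) D q (B n) /\ D <> A n.
  have [D [q [F [hn cE]]]] := ball_cycle_ncycle hc (special_on_cycle hl hs hc).
  have [DS FS DF] := ncycle_neq hn.
  move: Bc; rewrite cE inE => /orP[/eqP BS|]; first by case: AB; rewrite BS.
  rewrite inE => /orP[/eqP->|Bq].
    exists F, (rev q); split; first exact: ncycle_rev.
    by rewrite -SA.
  have -> : B n = F.
    apply: (special_no_chord hl hs hn _ Bq).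
    have [b Bb] := class_inh (split_B hs n.+1).
    apply/ball_edgeP; split; [exact: (split_S hs)|exact: (split_B hs)|].
    have [y By bY] := split_BB hs Bb; exists b, y; split=> //.
    exact: (subBS hs Bb).
  by exists D, q; rewrite -SA.
have [SD hn1] := ncycle_up_next hl hs' hn DA.
exact: (ncycle_detachedA hs hn hn1 SD).
Qed.

Lemma edgeS_A S A B C (hs : splitting phi S A B C) n :
  ball_edge phi n.+1 (S n.+1) (A n.+1).
Proof.
have [a Aa] := class_inh (split_A hs n.+2); have [y Ay ay] := split_AA hs Aa.
apply/ball_edgeP; split; [exact: (split_S hs)|exact: (split_A hs)|].
by exists a, y; split=> //; exact: (subAS hs Aa).
Qed.

Lemma edgeS_B S A B C (hs : splitting phi S A B C) n :
  ball_edge phi n.+1 (S n.+1) (B n.+1).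
Proof. exact: (edgeS_A (splitting_sym hs)). Qed.

Lemma edge_A_up S A B C (hs : splitting phi S A B C) n : S n <> A n ->
  ball_edge phi n.+1 (A n.+1) (A n).
Proof.
move=> SA; have [a Aa] := class_inh (split_A hs n.+1); have [y Ay ay] := split_AA hs Aa.
apply/ball_edgeP; split; [exact: (split_A hs)| |by exists a, y].
by apply: (class_up hs (split_A hs n)); exact: nesym.
Qed.

Lemma edge_B_up S A B C (hs : splitting phi S A B C) n : S n <> B n ->
  ball_edge phi n.+1 (B n.+1) (B n).
Proof. exact: (edge_A_up (splitting_sym hs)). Qed.

(** Here [S n.+1] is [A n] as a set, so [A n] is adjacent to [B n.+1]; with the edge from [B n.+1]
    to [B n], this lets [B n.+1] replace [S n]. *)
Lemma cycle_center_A S A B C (hs : splitting phi S A B C) n q :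
  ncycle phi n (S n) (A n) q (B n) -> C n = A n -> detached phi S A n.+1 setT.
Proof.
move=> hn CA; have [AS BS AB] := ncycle_neq hn.
have SA : S n.+1 = A n.
  have [x Sx] := class_inh (split_S hs n.+1).
  apply: (classes_disjoint (split_S hs _) (class_up hs (split_A hs n) AS) Sx).
  by rewrite -CA; exact: (split_SC hs Sx).
apply: (ncycle_detachedA hs hn _ SA).
apply: (ncycle_up hs hn (split_B hs _) (@subBS _ _ _ _ _ _ _ hs n)).
  by rewrite -SA; apply: ball_edge_sym; exact: (edgeS_B hs).
by apply: ball_edge_sym; apply: (edge_B_up hs); exact: nesym.
Qed.

(** Both parts of [S n] are kept: the cycle opens into a path from [A n.+1] to [B n.+1], to be
    closed by an edge or by a further class. *)
Lemma ncycle_path_up S A B C (hs : splitting phi S A B C) n q :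
  ncycle phi n (S n) (A n) q (B n) ->
  path (fun X Y => `[< ball_edge phi n.+1 X Y >]) (A n.+1)
    (A n :: rcons (rcons q (B n)) (B n.+1)).
Proof.
move=> hn; have [AS BS AB] := ncycle_neq hn; have [Dq _ _ /andP[Sn _]] := hn.
rewrite /= rcons_path last_rcons; apply/and3P; split.
- by apply/asboolP; apply: (edge_A_up hs); exact: nesym.
- exact: (path_up hs Dq Sn).
- by apply/asboolP; apply: ball_edge_sym; apply: (edge_B_up hs); exact: nesym.
Qed.

Lemma ncycle_uniq_up S A B C (hs : splitting phi S A B C) n q :
  ncycle phi n (S n) (A n) q (B n) ->
  uniq (A n.+1 :: A n :: rcons (rcons q (B n)) (B n.+1)).
Proof.
move=> hn; have [_ _ _] := hn; rewrite cons_uniq => /andP[_ uq].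
have nA := split_notin hs hn (split_A hs _) (@subAS _ _ _ _ _ _ _ hs n).
have nB := split_notin hs hn (split_B hs _) (@subBS _ _ _ _ _ _ _ hs n).
rewrite cons_uniq -rcons_cons rcons_uniq nB uq mem_rcons inE negb_or nA !andbT.
by apply/eqP; exact: (@neqAB _ _ _ _ _ _ _ hs n.+1).
Qed.

(** [S n.+1] lies in [S n], so it is one of its two parts; being adjacent to the other, it closes
    the path. *)
Lemma cycle_center_S S A B C (hs : splitting phi S A B C) n q :
  ncycle phi n (S n) (A n) q (B n) -> C n = S n ->
  exists c, [/\ ball_cycle phi n.+1 c, A n.+1 \in c, B n.+1 \in c &
    S n.+1 = A n.+1 \/ S n.+1 = B n.+1].
Proof.
move=> hn CS.
have SAB : S n.+1 = A n.+1 \/ S n.+1 = B n.+1.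
  have [x Sx] := class_inh (split_S hs n.+1).
  have : S n x by rewrite -CS; exact: (split_SC hs Sx).
  by move=> /(split_SAB hs)[]; [left|right]; apply: (classes_disjoint _ _ Sx) => //;
    [exact: (split_S hs)|exact: (split_A hs)|exact: (split_S hs)|exact: (split_B hs)].
have AB : ball_edge phi n.+1 (B n.+1) (A n.+1).
  case: SAB => e; first by apply: ball_edge_sym; rewrite -{1}e; exact: (edgeS_B hs).
  by rewrite -{1}e; exact: (edgeS_A hs).
exists (A n.+1 :: A n :: rcons (rcons q (B n)) (B n.+1)); split=> //.
- apply: ncycle_ball_cycle; have := ncycle_path_up hs hn.
  rewrite /= => /andP[/asboolP AA pq]; split=> //.
  exact: (ncycle_uniq_up hs hn).
- by rewrite mem_head.
- by rewrite !inE mem_rcons inE eqxx !orbT.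
Qed.

(** [S n.+1], equal to [C n], is off the path and adjacent to both of its ends, so it closes the
    path into a cycle longer by two than the old one. *)
Lemma cycle_center_other S A B C (hs : splitting phi S A B C) n q :
  ncycle phi n (S n) (A n) q (B n) -> C n <> S n -> C n <> A n -> C n <> B n ->
  exists c, ball_cycle phi n.+1 c /\ size c = (size q).+3.+2.
Proof.
move=> hn CS CA CB.
have [SC SnS] : S n.+1 = C n /\ S n.+1 <> S n.
  apply: (specialS_center hs).
    move=> SA; apply: CS; have [x Ax] := class_inh (split_A hs n.+1).
    apply: (classes_disjoint (split_C hs n) (split_S hs n) _ (subAS hs Ax)).
    by apply: (split_SC hs); rewrite SA.
  move=> SB; apply: CS; have [x Bx] := class_inh (split_B hs n.+1).
  apply: (classes_disjoint (split_C hs n) (split_S hs n) _ (subBS hs Bx)).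
  by apply: (split_SC hs); rewrite SB.
have Sc : S n.+1 \notin A n.+1 :: A n :: rcons (rcons q (B n)) (B n.+1).
  have nS X : X `<=` S n -> S n.+1 <> X.
    move=> XS e; have [x Sx] := class_inh (split_S hs n.+1).
    apply: CS; apply: (classes_disjoint (split_C hs n) (split_S hs n) (split_SC hs Sx)).
    by apply: XS; rewrite -e.
  apply/negP; rewrite inE -rcons_cons mem_rcons inE => /or3P[/eqP|/eqP|].
  - by apply: nS; exact: (@subAS _ _ _ _ _ _ _ hs n).
  - by apply: nS; exact: (@subBS _ _ _ _ _ _ _ hs n).
  (* [C n] is adjacent to [S n], so on the old cycle it could only be [A n] or [B n]. *)
  rewrite SC inE => /orP[/eqP //|Cq]; apply: CB.
  apply: (special_no_chord hl hs hn _ Cq).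
  have [x Ax] := class_inh (split_A hs n.+2); have [y Ay xy] := split_AA hs Ax.
  apply/ball_edgeP; split; [exact: (split_S hs)|exact: (split_C hs)|].
  exists y, x; rewrite adjC; split=> //; first exact: (subAS hs Ay).
  by apply: (split_SC hs); exact: (subAS hs Ax).
exists (A n.+1 :: A n :: rcons (rcons (rcons q (B n)) (B n.+1)) (S n.+1)); split.
  apply: ncycle_ball_cycle; have := ncycle_path_up hs hn.
  rewrite /= => /andP[/asboolP AA pq]; split=> //.
  - rewrite rcons_path last_rcons pq /=; apply/asboolP.
    by apply: ball_edge_sym; exact: (edgeS_B hs).
  - exact: (edgeS_A hs).
  - rewrite -!rcons_cons rcons_uniq !rcons_cons Sc /=.
    exact: (ncycle_uniq_up hs hn).
by rewrite /= !size_rcons.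
Qed.

(** * Every cycle leads to a detached class *)

Section Main.
Variables S A B C : nat -> set T.
Hypothesis hs : splitting phi S A B C.

Definition detached_some n := detached phi S B n setT \/ detached phi S A n setT.

Lemma detached_someS n : detached_some n -> detached_some n.+1.
Proof.
by case=> h; [left; exact: (detachedS hl hs h)|
  right; exact: (detachedS hl (splitting_sym hs) h)].
Qed.

Lemma outside_detached n c : ball_cycle phi n c ->
  A n \notin c \/ B n \notin c -> detached_some n.
Proof.
by move=> hc [] nc; [right|left]; exists c; split=> //; exact: (special_on_cycle hl hs hc).
Qed.

(** If [A n] and [B n] are on the cycle and differ from [S n], they are its two neighbors there, and
    [C n], also adjacent to [S n], must be one of them. *)
Lemma S_C_detached n : S_C_on_cycle phi S C n -> detached_some n.+1.
Proof.
move=> [SC [c [hc Sc Cc]]]; have hs' := splitting_sym hs.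
case: (boolP (A n \in c)) => [Ac|Ac]; last first.
  by apply: detached_someS; apply: outside_detached hc _; left.
case: (boolP (B n \in c)) => [Bc|Bc]; last first.
  by apply: detached_someS; apply: outside_detached hc _; right.
case: (pselect (S n = A n)) => [SA|SA].
  by right; exact: (cycle_special_A hs hc SA Bc).
case: (pselect (S n = B n)) => [SB|SB].
  by left; exact: (cycle_special_A hs' hc SB Ac).
have [q [hn cE]] := ncycle_both hs hc Ac Bc SA SB.
move: Cc; rewrite cE inE => /orP[/eqP CS|]; first by case: SC.
rewrite inE => /orP[/eqP CA|Cq]; first by right; exact: (cycle_center_A hs hn CA).
left; apply: (cycle_center_A hs' (ncycle_rev hn)).
apply: (special_no_chord hl hs hn _ Cq).
have nC := split_C hs n; have [x Ax] := class_inh (split_A hs n.+2).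
have [y Ay xy] := split_AA hs Ax.
apply/ball_edgeP; split=> //; first exact: (split_S hs).
exists y, x; rewrite adjC; split=> //; first exact: (subAS hs Ay).
by apply: (split_SC hs); exact: (subAS hs Ax).
Qed.

(** In the only case that needs the induction, the cycle grows by two while the number of classes
    grows by one, so fewer classes are left off the cycle. *)
Lemma cycle_detached n c : ball_cycle phi n c -> exists k, detached_some k.
Proof.
have [k] := ubnP (n.+3 - size c); elim: k n c => // k IH n c hk hc.
have hs' := splitting_sym hs.
case: (boolP (A n \in c)) => [Ac|Ac]; last first.
  by exists n; apply: outside_detached hc _; left.
case: (boolP (B n \in c)) => [Bc|Bc]; last first.
  by exists n; apply: outside_detached hc _; right.
case: (pselect (S n = A n)) => [SA|SA].
  by exists n.+1; right; exact: (cycle_special_A hs hc SA Bc).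
case: (pselect (S n = B n)) => [SB|SB].
  by exists n.+1; left; exact: (cycle_special_A hs' hc SB Ac).
have [q [hn cE]] := ncycle_both hs hc Ac Bc SA SB.
case: (pselect (C n = S n)) => [CS|CS].
  have [c' [hc' Ac' Bc' [SA'|SB']]] := cycle_center_S hs hn CS; exists n.+2.
    by right; exact: (cycle_special_A hs hc' SA' Bc').
  by left; exact: (cycle_special_A hs' hc' SB' Ac').
case: (pselect (C n = A n)) => [CA|CA].
  by exists n.+1; right; exact: (cycle_center_A hs hn CA).
case: (pselect (C n = B n)) => [CB|CB].
  by exists n.+1; left; exact: (cycle_center_A hs' (ncycle_rev hn) CB).
have [c' [hc' sc']] := cycle_center_other hs hn CS CA CB.
apply: (IH n.+1 c' _ hc').
have cs : size c = (size q).+3.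
  have [_ uc _] := hc; have [_ _ _ uq] := hn.
  by rewrite (perm_size (uniq_perm uc uq cE)) /= size_rcons.
have : size c <= n.+2.
  by apply: (split_card hs); [case: hc|move=> X; exact: ball_cycle_class].
by move: hk; rewrite sc' cs => h1 h2; move: h1; rewrite !subSS; lia.
Qed.

End Main.
End Detachment.

(** * Automorphisms from equitable partitions *)


Section RootedTree.
Variables (d : nat) (T : regular_tree d) (r : T).
Implicit Types (x y z u v w : T) (n k : nat).

Lemma depth_ex x : exists n, `[< cball n r x >].
Proof.
have [p rp px] := tree_connected r x.
by exists (size p); apply/asboolP; exists p.
Qed.

Definition depth x := ex_minn (depth_ex x).

Lemma depthP n x : cball n r x <-> depth x <= n.
Proof.
rewrite /depth; case: ex_minnP => m /asboolP rm mmin; split=> [rx|mn].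
  by apply: mmin; apply/asboolP.
exact: cball_le rm.
Qed.

Lemma depth_root : depth r = 0.
Proof. by apply/eqP; rewrite -leqn0; apply/depthP; exact: cball_center. Qed.

Lemma depth0 x : depth x = 0 -> x = r.
Proof. by move=> x0; apply: cball0; apply/depthP; rewrite x0. Qed.

Lemma depth_adj x y : adj x y -> depth y <= (depth x).+1.
Proof.
move=> xy; apply/depthP; have /depthP[p [rp px pn]] := leqnn (depth x).
exists (rcons p y); rewrite rcons_path rp px last_rcons size_rcons.
by split.
Qed.

(** The default value [r] makes the root its own parent. *)
Definition parent x := xget r [set y | adj x y /\ (depth y).+1 = depth x].

Lemma parentP x : x <> r -> adj x (parent x) /\ (depth (parent x)).+1 = depth x.
Proof.
move=> xr; have [y xy] : exists y, adj x y /\ (depth y).+1 = depth x.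
  have /depthP[p] := leqnn (depth x); case: (lastP p) => [|{}p y] [].
    by move=> _ /= rx; case: xr.
  rewrite rcons_path last_rcons size_rcons => /andP[rp py] yx pn.
  exists (last r p); rewrite adjC -yx; split=> //; rewrite yx.
  have : depth (last r p) <= size p by apply/depthP; exists p.
  have := depth_adj py; rewrite yx; lia.
exact: (@xgetI _ r [set y | adj x y /\ (depth y).+1 = depth x] y xy).
Qed.

Lemma parent_root : parent r = r.
Proof. by apply: xgetPN => y /= []; rewrite depth_root. Qed.

(** Adding the parents at both ends either closes a cycle or gives such a path one level lower; at
    depth 0 both ends are the root. *)
Lemma depth_uniq_path k u v p : depth u = k -> depth v = k -> u <> v ->
  path (@adj d T) u p -> last u p = v -> uniq (u :: p) ->
  (forall z, z \in u :: p -> k <= depth z) -> False.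
Proof.
elim: k u v p => [|k IH] u v p uk vk uv up pv uup zk.
  by apply: uv; rewrite (depth0 uk) (depth0 vk).
have nr x : depth x = k.+1 -> x <> r by move=> xk xr; rewrite xr depth_root in xk.
have [uu] := parentP (nr _ uk); rewrite uk => -[duk].
have [vv] := parentP (nr _ vk); rewrite vk => -[dvk].
have nin x : depth x = k -> x \notin u :: p.
  by move=> xk; apply/negP => /zk; rewrite xk ltnn.
case: (pselect (parent u = parent v)) => [puv|puv].
  have := @tree_acyclic _ T (parent u :: u :: p).
  rewrite cons_uniq nin // uup => /(_ isT); rewrite /= rcons_path.
  rewrite -![_ \in nbr _]/(adj _ _) adjC uu up pv puv vv => /(_ isT).
  by case: p pv {up uup zk nin} => [|z p] //= /uv.
apply: (IH (parent u) (parent v) (u :: rcons p (parent v))) => //.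
- by rewrite /= adjC uu rcons_path up pv vv.
- by rewrite /= last_rcons.
- rewrite -rcons_cons cons_uniq mem_rcons inE negb_or nin // andbT.
  by rewrite rcons_uniq nin // uup !andbT; apply/eqP.
- move=> z; rewrite -rcons_cons inE => /orP[/eqP->|]; first by rewrite duk.
  by rewrite mem_rcons inE => /orP[/eqP->|/zk/ltnW//]; rewrite dvk.
Qed.

Lemma adj_parent u v : adj u v ->
  depth v = (depth u).+1 /\ parent v = u \/ depth u = (depth v).+1 /\ parent u = v.
Proof.
wlog: u v / depth u <= depth v.
  move=> h uv; case: (leqP (depth u) (depth v)) => [uv'|/ltnW vu]; first exact: h.
  by rewrite adjC in uv; case: (h v u vu uv); [right|left].
move=> duv uv; have uv' := adj_neq uv; left.
have := depth_adj uv; rewrite leq_eqVlt ltnS => /orP[/eqP e|vu].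
  split=> //; apply: contrapT => pvu.
  have [vp pv] : adj v (parent v) /\ (depth (parent v)).+1 = depth v.
    by apply: parentP => vr; rewrite vr depth_root in e.
  have dpv : depth (parent v) = depth u by lia.
  apply: (@depth_uniq_path (depth u) u (parent v) [:: v; parent v]) => //.
  - exact: nesym.
  - by rewrite /= uv vp.
  - rewrite /= !inE !negb_or !andbT -andbA; apply/and3P; split; apply/eqP => //.
      exact: nesym.
    exact: adj_neq.
  - by move=> z; rewrite !inE => /or3P[]/eqP->; rewrite ?dpv.
exfalso; apply: (@depth_uniq_path (depth u) u v [:: v]) => //=.
- by apply/eqP; rewrite eqn_leq duv vu.
- by rewrite uv.
- by rewrite !inE !andbT; apply/eqP.
- by move=> z; rewrite !inE => /orP[]/eqP->.
Qed.

End RootedTree.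

(** * Matchings that respect an equivalence relation *)

Section Matching.
Variables (U : choiceType) (R : U -> U -> Prop).
Hypothesis (Rrefl : forall x, R x x) (Rsym : forall x y, R x y -> R y x).
Hypothesis Rtrans : forall y x z, R x y -> R y z -> R x z.

Local Notation cnt z := (count (fun x => `[< R z x >])).

Lemma matching (s t : seq U) : uniq s -> uniq t ->
  (forall z, cnt z s = cnt z t) ->
  exists h, perm_eq (map h s) t /\ forall x, x \in s -> R x (h x).
Proof.
elim: s t => [|a s IH] t us ut st.
  exists id; split=> //; case: t ut st => // b t _ /(_ b).
  by rewrite /= asboolT.
have [b bt ab] : exists2 b, b \in t & R a b.
  have : has (fun x => `[< R a x >]) t by rewrite has_count -st /= asboolT.
  by move=> /hasP[b bt /asboolP ab]; exists b.
have tE := perm_to_rem bt.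
have /= /andP[aS us'] := us.
have [|z|h [hp hR]] := IH (rem b t) us'; first exact: rem_uniq.
  have := st z; rewrite (permP tE) /= => e; apply/eqP.
  rewrite -(eqn_add2l `[< R z a >]) e; apply/eqP; congr (nat_of_bool _ + _).
  apply/asbool_equiv_eq; split=> h; first exact: Rtrans (Rsym ab).
  exact: Rtrans ab.
exists (fun x => if x == a then b else h x); split=> [|x].
  rewrite /= eqxx perm_sym (perm_trans tE) // perm_cons perm_sym.
  rewrite (_ : map _ s = map h s) //; apply/eq_in_map => x xs.
  by case: eqP => // xa; rewrite -xa xs in aS.
by rewrite inE; case: eqP => [->|_ /=]; [|exact: hR].
Qed.

(** Removing the prescribed pair from both lists keeps the counts equal, and the rest is matched
    freely. *)
Lemma marked_matching (s t : seq U) p q : uniq s -> uniq t ->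
  (forall z, cnt z s = cnt z t) ->
  exists h, [/\ perm_eq (map h s) t, forall x, x \in s -> R x (h x) &
    p \in s -> q \in t -> R p q -> h p = q].
Proof.
move=> us ut st; case: (pselect [/\ p \in s, q \in t & R p q]) => [[ps qt pq]|n].
  have sE := perm_to_rem ps; have tE := perm_to_rem qt.
  have [||z|h [hp hR]] := @matching (rem p s) (rem q t); try exact: rem_uniq.
    have := st z; rewrite (permP tE) (permP sE) /= => e; apply/eqP.
    rewrite -(eqn_add2l `[< R z p >]) e; apply/eqP; congr (nat_of_bool _ + _).
    apply/asbool_equiv_eq; split=> h; first exact: Rtrans (Rsym pq).
    exact: Rtrans pq.
  exists (fun x => if x == p then q else h x); rewrite eqxx; split=> // [|x xs].
    rewrite (perm_trans (perm_map _ sE)) //= eqxx perm_sym (perm_trans tE) //.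
    rewrite perm_cons perm_sym (_ : map _ _ = map h (rem p s)) //.
    apply/eq_in_map => x; rewrite (mem_rem_uniq _ us) !inE.
    by case/andP => /negbTE ->.
  case: eqP => [->//|/eqP xp]; apply: hR.
  by rewrite (mem_rem_uniq _ us) !inE xp.
have [h [hp hR]] := matching us ut st; exists h; split=> // ps qt pq.
by case: n.
Qed.

End Matching.

(** * From local matchings to an automorphism *)

Section Automorphism.
Variables (d : nat) (T : regular_tree d) (phi : T -> bool) (R : T -> T -> Prop).
Implicit Types (x y z u v w : T) (n k : nat).
Hypothesis (Rrefl : forall x, R x x) (Rsym : forall x y, R x y -> R y x).
Hypothesis Rtrans : forall y x z, R x y -> R y z -> R x z.
Hypothesis Rphi : forall x y, R x y -> phi x = phi y.
Hypothesis Rcount : forall x y z, R x y ->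
  nb_count x [set w | R z w] = nb_count y [set w | R z w].

(** [p] and [q] are meant for the parent of [u] and its image. The data are packed in one tuple so
    that [choice] yields a single function. *)
Lemma local_iso (a : T * T * T * T) : exists h : T -> T,
  let: (u, v, p, q) := a in R u v ->
  [/\ perm_eq (map h (nbr u)) (nbr v), forall x, adj u x -> R x (h x) &
    adj u p -> adj v q -> R p q -> h p = q].
Proof.
case: a => [[[u v] p] q]; case: (pselect (R u v)) => uv; last by exists id.
have [||z|h hP] := @marked_matching _ R Rrefl Rsym Rtrans (nbr u) (nbr v) p q.
- exact: nbr_uniq.
- exact: nbr_uniq.
- have := Rcount z uv; rewrite /nb_count.
  by rewrite !(@eq_count _ _ (fun x => `[< R z x >])) // => x; rewrite inE.
by exists h.
Qed.

(* The automorphism is built along the paths from x0: a neighbor of u is sent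
   to a neighbor of g u, while the parent of u goes where it already went. *)
Lemma equitable_automorphism x0 y0 : R x0 y0 ->
  exists2 g, color_automorphism phi g & g x0 = y0.
Proof.
move=> Rxy; have [H HP] := choice local_iso.
pose par := parent x0; pose dep := depth x0.
(* With [n] the depth of [u] as fuel, [G] returns the image of the parent of [u] paired with the
   image of [u]. *)
pose G := fix G n u := if n is m.+1 then
    let bc := G m (par u) in (bc.2, H (par u, bc.2, par (par u), bc.1) u)
  else (y0, y0).
pose g u := (G (dep u) u).2.
have par0 : par x0 = x0 by exact: parent_root.
have dep0 : dep x0 = 0 by exact: depth_root.
have g0 : g x0 = y0 by rewrite /g dep0.
have parP u : u <> x0 -> adj u (par u) /\ (dep (par u)).+1 = dep u by exact: parentP.
have G1 u : (G (dep u) u).1 = g (par u).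
  case: (pselect (u = x0)) => [->|/parP[_]]; first by rewrite par0 dep0 g0.
  by rewrite /g; case: (dep u) => //= n [->].
have gE u : u <> x0 -> g u = H (par u, g (par u), par (par u), g (par (par u))) u.
  move=> /parP[_ du]; by rewrite {1}/g -du /= G1.
have gR n u : dep u <= n -> R u (g u) /\ (u <> x0 -> adj (g u) (g (par u))).
  elim: n u => [|n IH] u un.
    have -> : u = x0 by apply: (@depth0 _ _ x0); apply/eqP; rewrite -leqn0.
    by rewrite g0; split.
  case: (pselect (u = x0)) => [->|ux]; first by rewrite g0; split.
  have [up du] := parP u ux; have pn : dep (par u) <= n by lia.
  have [Rp _] := IH _ pn.
  have [hp hR _] := HP (par u, g (par u), par (par u), g (par (par u))) Rp.
  have pu : adj (par u) u by rewrite adjC.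
  rewrite (gE _ ux); split=> [|_]; first exact: hR.
  by rewrite adjC /adj -(perm_mem hp); apply: map_f.
have {}gR u : R u (g u) /\ (u <> x0 -> adj (g u) (g (par u))) by exact: gR (leqnn _).
(* [g] agrees with the local matching at [p] on all neighbors: on children by construction, on the
   parent because its image was prescribed. *)
have gnbr p : perm_eq (map g (nbr p)) (nbr (g p)).
  have [hp hR hm] := HP (p, g p, par p, g (par p)) (gR p).1.
  rewrite (_ : map g _ = map (H (p, g p, par p, g (par p))) (nbr p)) //.
  apply/eq_in_map => u pu.
  have [[du pau]|[dp pap]] := @adj_parent _ _ x0 _ _ pu.
    rewrite gE -/par ?pau; last by move=> ux; rewrite ux depth_root in du.
    by rewrite -/par in pau; rewrite pau.
  rewrite -/par in pap; have px : p <> x0 by move=> px; rewrite px depth_root in dp.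
  rewrite -pap hm //; [by rewrite pap|exact: (gR p).2|exact: (gR _).1].
have gadj x y : adj x y -> adj (g x) (g y).
  by move=> xy; rewrite /adj -(perm_mem (gnbr x)); apply: map_f.
have ginj_nbr p x y : adj p x -> adj p y -> g x = g y -> x = y.
  move=> px py; have : uniq (map g (nbr p)) by rewrite (perm_uniq (gnbr p)) nbr_uniq.
  move: px py; rewrite /adj; elim: (nbr p) => //= a s IH.
  rewrite !inE => /orP[/eqP->|xs] /orP[/eqP->|ys] /andP[aS us] gxy //.
  - by rewrite gxy map_f in aS.
  - by rewrite -gxy map_f in aS.
  - exact: IH.
(* There is no folding back: if [g u] were the parent of [g (par u)], then [u] and the grandparent,
   both neighbors of [par u], would have the same image. *)
have gdep n u : dep u = n -> depth y0 (g u) = n /\ parent y0 (g u) = g (par u).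
  elim: n u => [|n IH] u un.
    have -> : u = x0 by exact: depth0 un.
    by rewrite par0 g0 depth_root parent_root.
  have ux : u <> x0 by move=> ux; rewrite ux dep0 in un.
  have [up] := parP u ux; rewrite un => -[pn]; have [dp pp] := IH _ pn.
  have pu : adj (par u) u by rewrite adjC.
  have [[dgu pgu]|[dgp pgp]] := @adj_parent _ _ y0 _ _ (gadj _ _ pu).
    by rewrite dgu dp.
  exfalso; have px : par u <> x0.
    by move=> px; rewrite px g0 depth_root in dgp.
  have [pup dpp] := parP _ px.
  have : par (par u) = u by apply: (ginj_nbr (par u)) => //; rewrite -pp pgp.
  by move=> ppu; move: dpp; rewrite ppu un pn => /eqP; lia.
have ginj n x y : dep x = n -> g x = g y -> x = y.
  elim: n x y => [|n IH] x y xn gxy.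
    have yn : dep y = 0.
      have [<- _] := gdep _ y erefl; rewrite -gxy.
      by have [-> _] := gdep _ x erefl.
    by rewrite (depth0 xn) (depth0 yn).
  have yn : dep y = n.+1.
    have [<- _] := gdep _ y erefl; rewrite -gxy.
    by have [-> _] := gdep _ x erefl.
  have nx z : dep z = n.+1 -> z <> x0 by move=> zn zx; rewrite zx dep0 in zn.
  have [xp] := parP x (nx _ xn); rewrite xn => -[dxp].
  have [yp _] := parP y (nx _ yn).
  have pxy : par x = par y.
    apply: IH => //; have [_ <-] := gdep _ x erefl; have [_ <-] := gdep _ y erefl.
    by rewrite gxy.
  by apply: (ginj_nbr (par x)) => //; rewrite adjC // pxy.
have {}ginj : injective g by move=> x y; exact: ginj.
have gsurj n w : depth y0 w = n -> exists u, g u = w.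
  elim: n w => [|n IH] w wn; first by exists x0; rewrite g0 (depth0 wn).
  have wy : w <> y0 by move=> wy; rewrite wy depth_root in wn.
  have [wp] := parentP wy; rewrite wn => -[/IH[p gp]].
  rewrite adjC -gp /adj -(perm_mem (gnbr p)) in wp.
  by have /mapP[u _ ->] := wp; exists u.
exists g => //; split.
- have [g' g'P] := choice (fun w => gsurj _ w erefl).
  by exists g' => // x; apply: ginj; rewrite g'P.
- by move=> x y; rewrite /adj -(perm_mem (gnbr x)) mem_map.
- by move=> x; rewrite -(Rphi (gR x).1).
Qed.

End Automorphism.

(** * The quotient ray *)


Section Quotient.
Variables (d : nat) (T : regular_tree d) (phi : T -> bool).
Implicit Types (x y z u v w : T) (n k : nat) (X Y Z D F : set T).

Local Notation cl := (bclass phi).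

Lemma nb_count_gt0 x X : 0 < nb_count x X <-> touches x X.
Proof.
rewrite /nb_count -has_count; split=> [/hasP[y xy]|[y Xy xy]].
  by rewrite inE; exists y.
by apply/hasP; exists y => //; rewrite inE.
Qed.

Lemma automorphism_equiv_all g x :
  color_automorphism phi g -> equiv_all phi x (g x).
Proof.
move=> [[g' gK g'K] gadj gphi] n.
have path_g y p : path (@adj d T) (g y) (map g p) = path (@adj d T) y p.
  by elim: p y => //= z p IH y; rewrite gadj IH.
exists g; split=> //; split.
- move=> y [p [xp py pn]]; exists (map g p).
  by rewrite path_g last_map py size_map.
- by move=> u v _ _ /(can_inj gK).
- move=> y [p [xp py pn]]; exists (g' y) => //.
  exists (map g' p); split; last by rewrite size_map.
    by rewrite -path_g -map_comp (eq_map (g := id)) ?map_id.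
  by rewrite -(gK x) last_map py.
Qed.

Variables S A B C : nat -> set T.
Hypothesis hs : splitting phi S A B C.
Hypothesis hb : forall x, exists t, settled S t x.

Local Notation rk := (rank S).
Definition level n : set T := [set x | rk x = n].

Lemma level_class n x : rk x <= n -> level (rk x) = cl n x.
Proof.
move=> xn; apply/seteqP; split=> y.
  by move=> /esym/(rank_equiv hs hb) /(_ n).
by move=> /(rank_le_equiv hs hb xn) /(equiv_all_rank hs hb) /esym.
Qed.

(** The levels form an equitable partition that respects the coloring, so [equitable_automorphism]
    moves [x] to any vertex of its rank. *)
Lemma orbit_level x : Defs.orbit phi x = level (rk x).
Proof.
apply/seteqP; split=> y.
  move=> [g /(@automorphism_equiv_all g x) xg <-].
  by apply/esym; exact: (equiv_all_rank hs hb xg).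
move=> /esym xy; pose R u v := rk u = rk v.
have Rphi u v : R u v -> phi u = phi v.
  by move=> /(rank_equiv hs hb) /(_ 0) /ball_equiv0.
have Rcount u v z : R u v ->
    nb_count u [set w | R z w] = nb_count v [set w | R z w].
  move=> /(rank_equiv hs hb) uv.
  rewrite (_ : [set w | R z w] = cl (rk z) z); first exact: ball_equiv_count.
  by rewrite -(@level_class (rk z) z) //; apply/seteqP; split=> w /=; exact: esym.
have [g gP gx] := @equitable_automorphism _ _ phi R (fun=> erefl)
  (fun u v => @esym _ _ _) (fun v u w => @etrans _ _ _ _) Rphi Rcount x y xy.
by exists g.
Qed.

(** Descent on the rank of [z]. Each neighbor of [Z] on the cycle has a vertex next to [z]; its rank
    is not smaller by induction, not equal since its class would be [Z], hence larger by one. Then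
    the two neighbors of [Z] coincide. *)
Lemma settled_class_off_cycle n c Z z : ball_cycle phi n c -> Z \in c -> Z z ->
  rk z <= n -> False.
Proof.
move=> hc; have [k] := ubnP (rk z); elim: k Z z => // k IH Z z zk Zc Zz zn.
have [D [q [F [hn cE]]]] := ball_cycle_ncycle hc Zc.
have [DZ FZ DF] := ncycle_neq hn; have [_ ZD FZ' _] := hn.
have nZ := ball_cycle_class hc Zc.
have ZS : Z <> S n.
  by move=> ZS; rewrite ZS in Zz; have := special_lt_rank hb Zz; rewrite ltnNge zn.
have Dc : D \in c by rewrite cE !inE eqxx orbT.
have Fc : F \in c by rewrite cE !inE mem_rcons inE eqxx !orbT.
have nbr_rank W w : W \in c -> W <> Z -> W w -> adj z w -> rk w = (rk z).+1.
  move=> Wc WZ Ww zw; have := rank_adj hs hb zw.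
  rewrite leq_eqVlt => /orP[/eqP //|]; rewrite ltnS leq_eqVlt => /orP[/eqP e|wz].
    case: WZ; apply: (classes_disjoint (ball_cycle_class hc Wc) nZ Ww).
    apply: class_closed nZ Zz _; apply: (rank_equiv hs hb); exact: esym.
  case: (IH W w) => //; first exact: leq_trans wz zk.
  by apply: leq_trans zn; exact: ltnW.
have [u Du zu] := edge_touches hs ZD ZS Zz.
have [v Fv zv] := edge_touches hs (ball_edge_sym FZ') ZS Zz.
apply: DF; apply: (classes_disjoint (ball_cycle_class hc Dc) (ball_cycle_class hc Fc) _ Fv).
apply: (class_closed (ball_cycle_class hc Dc) Du); apply: (rank_equiv hs hb).
by rewrite (nbr_rank D u Dc DZ Du zu) (nbr_rank F v Fc FZ Fv zv).
Qed.

Hypothesis hl : linear phi.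

Lemma no_cycle0 c : ~ ball_cycle phi 0 c.
Proof.
move=> hc; have [c2 uc _] := hc.
have := split_card hs uc (fun X => @ball_cycle_class _ _ _ 0 c X hc).
by rewrite leqNgt c2.
Qed.

(** A rank at most [m] yields some [y] of rank exactly [m]. The one of [A m] and [B m] that contains
    [y] is off the cycle, as [y] is settled at [m], and [detachedS_S_C] contradicts minimality at
    [m - 1]. *)
Lemma rank_min m : S_C_on_cycle phi S C m ->
  (forall k, S_C_on_cycle phi S C k -> m <= k) -> forall x, m < rk x.
Proof.
move=> [SC [c [hc Sc Cc]]] mmin x; rewrite ltnNge; apply/negP => xm.
case: m => [|n] in SC hc Sc Cc mmin xm *; first exact: no_cycle0 hc.
have [y yn] := rank_surj hs hb xm; have Sy := rank_special hb yn.
have off Z : Z y -> Z \notin c.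
  move=> Zy; apply/negP => Zc; apply: settled_class_off_cycle hc Zc Zy _.
  by rewrite yn.
suff /mmin : S_C_on_cycle phi S C n by rewrite ltnn.
have hs' := splitting_sym hs.
move: Sy => /(split_SAB hs)[/off Ac|/off Bc].
  by apply: (@detachedS_S_C _ _ _ hl _ _ _ _ hs' n setT); exists c.
by apply: (@detachedS_S_C _ _ _ hl _ _ _ _ hs n setT); exists c.
Qed.

(** * Ordering of the quotient by the rank *)

Section Ray.
Variable m : nat.
Hypothesis hd : detached phi S B m.+1 setT.
Hypothesis hm : forall x, m < rk x.

(** [B n] is contained in [S n.-1], so its ranks are at least [n]; being detached, it is settled at
    [n]. *)
Lemma B_level n : m < n -> B n = level n.
Proof.
move=> mn; have BR x : B n x -> rk x = n.
  move=> Bx; apply/eqP; rewrite eqn_leq; apply/andP; split.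
    apply/(rankP hb); apply: (detached_settled hl hs _ Bx).
    exact: (detached_le hl hs mn hd).
  by case: n mn Bx => // n mn /(subBS hs) /(special_lt_rank hb).
apply/seteqP; split=> // x xn; have [y By] := class_inh (split_B hs n).
apply: (class_closed (split_B hs n) By); apply: (rank_equiv hs hb).
by rewrite (BR _ By).
Qed.

Lemma level_inh n : m < n -> exists x, rk x = n.
Proof.
by move=> mn; have [x] := class_inh (split_B hs n); rewrite B_level //; exists x.
Qed.

Lemma orbitP X : range (Defs.orbit phi) X <-> exists2 n, m < n & X = level n.
Proof.
split=> [[x _ <-]|[n /level_inh[x <-] ->]].
  by exists (rk x) => //; exact: orbit_level.
by exists x => //; exact: orbit_level.
Qed.

Lemma level_inj n n' : m < n -> level n = level n' -> n = n'.
Proof.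
move=> /level_inh[x xn] e; have : level n x by [].
by rewrite e => <-; rewrite -xn.
Qed.

Lemma level_edge n n' : m < n -> m < n' -> n <> n' ->
  edge (quotient_graph phi) (level n) (level n') <-> n' = n.+1 \/ n = n'.+1.
Proof.
have up j : m < j -> exists x y, [/\ rk x = j, rk y = j.+1 & adj x y].
  move=> mj; have [y yj] := level_inh (ltnW (mj : m.+1 < j.+1)).
  have : B j.+1 y by rewrite B_level //; exact: ltnW.
  by move=> /(split_BB hs)[x]; rewrite B_level // adjC; exists x, y.
move=> mn mn' nn'; split=> [[k k0 [x xn xk]]|].
  have [y yn' xy] : touches x (level n') by apply/nb_count_gt0; rewrite xk.
  have := rank_adj hs hb xy; rewrite adjC in xy; have := rank_adj hs hb xy.
  by rewrite (xn : rk x = n) (yn' : rk y = n'); lia.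
have edge x y : rk x = n -> rk y = n' -> adj x y ->
    edge (quotient_graph phi) (level n) (level n').
  move=> xn yn' xy; exists (nb_count x (level n')); last by exists x.
  by apply/nb_count_gt0; exists y.
case=> e; first by have [x [y [xn yn xy]]] := up n mn; apply: (edge x y); rewrite ?e.
by have [x [y [xn yn xy]]] := up n' mn'; apply: (edge y x); rewrite ?e // adjC.
Qed.

Lemma quotient_ray :
  ray_enumeration (quotient_graph phi) (fun i => level (m.+1 + i)).
Proof.
have mi i : m < m.+1 + i by rewrite addSn ltnS leq_addr.
split; first split.
- by move=> i _; apply/orbitP; exists (m.+1 + i).
- by move=> i j _ _ /(level_inj (mi i)) /addnI.
- move=> X /orbitP[n mn ->]; exists (n - m.+1) => //.
  by rewrite subnKC.
move=> i j ij; rewrite level_edge //; first by lia.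
by move=> /addnI.
Qed.

(** The end vertex is forced: were [s 0] above [m.+1], the ranks just above and just below it would
    both be numbered 1. The rest follows by induction, as no rank is repeated. *)
Lemma quotient_ray_unique (x : nat -> set T) : ray_enumeration (quotient_graph phi) x ->
  forall i, x i = level (m.+1 + i).
Proof.
move=> [[xv xinj xsurj] xedge].
have /choice[s sP] : forall i, exists n, m < n /\ x i = level n.
  by move=> i; have /orbitP[n mn ->] := xv i I; exists n.
have sinj i j : s i = s j -> i = j.
  have [_ si] := sP i; have [_ sj] := sP j.
  by move=> e; apply: xinj; rewrite ?inE // si sj e.
have ssurj n : m < n -> exists i, s i = n.
  move=> mn; have [|i _ xi] := xsurj (level n); first by apply/orbitP; exists n.
  exists i; have [msi si] := sP i; apply: (level_inj msi).
  by rewrite -si.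
have sedge i j : i <> j -> (s j = (s i).+1 \/ s i = (s j).+1) <-> (j = i.+1 \/ i = j.+1).
  move=> ij; have [mi si] := sP i; have [mj sj] := sP j.
  rewrite -(xedge i j) // si sj level_edge //.
  by move=> /sinj.
have s0 : s 0 = m.+1.
  have [m0 _] := sP 0; apply/eqP; rewrite eqn_leq m0 andbT leqNgt; apply/negP => ms.
  have [i si] := ssurj (s 0).+1 (ltnW m0).
  have [|j sj] := ssurj (s 0).-1; first by lia.
  have i1 : i = 1.
    have i0 : 0 <> i by move=> i0; rewrite -i0 in si; lia.
    by have [h _] := sedge 0 i i0; case: (h (or_introl si)) => //; lia.
  have j1 : j = 1.
    have j0 : 0 <> j by move=> j0; rewrite -j0 in sj; lia.
    have hp : s j = (s 0).+1 \/ s 0 = (s j).+1 by right; lia.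
    by have [h _] := sedge 0 j j0; case: (h hp); lia.
  by rewrite i1 in si; rewrite j1 in sj; lia.
suff sE i : s i = m.+1 + i by move=> i; have [_ ->] := sP i; rewrite sE.
have [k] := ubnP i; elim: k i => // k IH [|i] ik; first by rewrite s0 addn0.
have si := IH i (ltac:(lia)).
have [_ h] := sedge i i.+1 (ltac:(lia)).
case: (h (or_introl erefl)) => e; first by rewrite e si addnS.
case: i => [|i] in ik si h e *; first by have [m1 _] := sP 1; lia.
have si' := IH i (ltac:(lia)).
have : i = i.+2 by apply: sinj; lia.
by lia.
Qed.

End Ray.
End Quotient.

(** * Star graphs and direct limits *)


Section Isomorphisms.
Variables (W : choiceType).
Implicit Types G H K : eigraph W.

Lemma eisomorphic_refl G : eisomorphic G G.
Proof.
exists id; split=> //; split=> //.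
by move=> u Gu; exists u.
Qed.

Lemma eisomorphic_trans G H K :
  eisomorphic G H -> eisomorphic H K -> eisomorphic G K.
Proof.
move=> [f [[fv finj fsurj] fi]] [g [[gv ginj gsurj] gi]]; exists (g \o f).
split; first split.
- by move=> u /fv /gv.
- move=> u v; rewrite !inE => Gu Gv /= e; apply: finj; rewrite ?inE //.
  by apply: ginj; rewrite ?inE //; exact: fv.
- by move=> w /gsurj[v /fsurj[u Gu <-] <-]; exists u.
- by move=> u v Gu Gv k; rewrite fi // gi //; exact: fv.
Qed.

Lemma eisomorphic_sym G H : eisomorphic G H -> eisomorphic H G.
Proof.
move=> [f [[fv finj fsurj] fi]].
case: (pselect (exists w, vert G w)) => [[w0 Gw0]|nG]; last first.
  exists id; split; first split.
  - by move=> v /fsurj[u Gu _]; case: nG; exists u.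
  - by move=> u v; rewrite inE => /fsurj[x Gx _]; case: nG; exists x.
  - by move=> u Gu; case: nG; exists u.
  - by move=> u v /fsurj[x Gx _]; case: nG; exists x.
pose g v := xget w0 [set u | vert G u /\ f u = v].
have gP v : vert H v -> vert G (g v) /\ f (g v) = v.
  move=> /fsurj[u Gu fu].
  exact: (@xgetI _ w0 [set u | vert G u /\ f u = v] u (conj Gu fu)).
exists g; split; first split.
- by move=> v /gP[].
- by move=> u v; rewrite !inE => /gP[_ {2}<-] /gP[_ {2}<-] ->.
- move=> u Gu; exists (f u); first exact: fv.
  by have [Gg fg] := gP _ (fv _ Gu); apply: finj; rewrite ?inE.
- by move=> u v /gP[Gu fu] /gP[Gv fv'] k; rewrite -[in X in X <-> _]fu -[in X in X <-> _]fv' fi.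
Qed.

End Isomorphisms.

(** * Pushing vertices along a direct system *)

Section Limit.
Variables (W : Type) (G : nat -> eigraph W) (e : nat -> W -> W).

Lemma push_refl n u : push e n n u = u.
Proof. by rewrite /push subnn. Qed.

Lemma pushS n N u : n <= N -> push e n N.+1 u = e N (push e n N u).
Proof. by move=> nN; rewrite /push subSn //= subnKC. Qed.

Lemma push_trans n N N' u : n <= N -> N <= N' ->
  push e n N' u = push e N N' (push e n N u).
Proof.
move=> nN /subnK <-; elim: (N' - N) => [|k IH]; first by rewrite add0n push_refl.
rewrite addSn !pushS ?IH ?leq_addl //.
by rewrite (leq_trans nN) // leq_addl.
Qed.

Lemma eq_germ m p p' N : p.1 <= N -> p'.1 <= N ->
  push e p.1 N p.2 = push e p'.1 N p'.2 -> germ G e m p = germ G e m p'.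
Proof.
have sub r r' : r.1 <= N -> r'.1 <= N -> push e r.1 N r.2 = push e r'.1 N r'.2 ->
    germ G e m r `<=` germ G e m r'.
  move=> rN r'N rr' q [mq Gq [M [rM qM rq]]]; split=> //.
  exists (maxn N M); split; [exact: leq_trans r'N (leq_maxl _ _)|
    exact: leq_trans qM (leq_maxr _ _)|].
  rewrite (push_trans _ r'N (leq_maxl _ _)) -rr' -push_trans ?leq_maxl //.
  rewrite (push_trans _ qM (leq_maxr _ _)) -rq -push_trans ?leq_maxr //.
by move=> pN p'N pp'; apply/seteqP; split; apply: sub.
Qed.

Lemma germ_self m p : m <= p.1 -> vert (G p.1) p.2 -> germ G e m p p.
Proof. by move=> mp Gp; split=> //; exists p.1. Qed.

End Limit.

(** * Star graphs from level [m] on *)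

Section Star.
Variables (d : nat) (T : regular_tree d) (phi : T -> bool).
Implicit Types (x y z u v w : T) (n k : nat) (X Y Z D F U : set T).


Variables S A B C : nat -> set T.
Hypothesis hs : splitting phi S A B C.
Hypothesis hb : forall x, exists t, settled S t x.
Hypothesis hl : linear phi.
Variable m : nat.
Hypothesis hd : detached phi S B m.+1 setT.
Hypothesis hm : forall x, m < rank S x.

Local Notation rk := (rank S).
Local Notation lev := (level S).
Local Notation ext E n := (star_extension phi S E n).

Let B_lev n : m < n -> B n = lev n := @B_level _ _ _ _ _ _ _ hs hb hl m hd n.

Lemma star_ext_special P n : ext P n (S n) = P n.+1.
Proof. by rewrite /star_extension eqxx. Qed.

Lemma star_ext_nonspecial P n U : bclasses phi n U -> U <> S n -> ext P n U = U.
Proof.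
move=> nU US; rewrite /star_extension; case: eqP => // _.
have restrE W : restricts phi n W U -> W = U.
  move=> [x -> Ux]; rewrite Ux (class_eqS hs) // => Sx; apply: US.
  by apply: (classes_disjoint nU (split_S hs n) _ Sx); rewrite Ux; exact: bclass_self.
have [x Ux] := class_inh nU.
apply: restrE; apply: (@xgetI _ set0 [set W | restricts phi n W U] U).
have nSx := nonspecial hs nU US Ux.
by exists x; [rewrite (class_eqS hs nSx)|]; exact: bclasses_eq.
Qed.

(** Classes of vertices not settled at [n]; for [m <= n] all vertices of the star graph of [A] are
    of this kind. *)
Definition live n X := bclasses phi n X /\ forall x, X x -> n < rk x.

Lemma live_special n : live n (S n).
Proof. by split=> [|x]; [exact: (split_S hs)|exact: special_lt_rank]. Qed.

Lemma ext_class n X : bclasses phi n X -> bclasses phi n.+1 (ext A n X).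
Proof.
move=> nX; case: (pselect (X = S n)) => [->|XS].
  by rewrite star_ext_special; exact: (split_A hs).
by rewrite star_ext_nonspecial //; exact: (class_up hs nX XS).
Qed.

Lemma ext_sub n X : bclasses phi n X -> ext A n X `<=` X.
Proof.
move=> nX; case: (pselect (X = S n)) => [->|XS].
  by rewrite star_ext_special; exact: (@subAS _ _ _ _ _ _ _ hs n).
by rewrite star_ext_nonspecial.
Qed.

Lemma star_indexE n X Y k : bclasses phi n X -> star_index S A n X Y k <->
  exists2 x, ext A n X x & nb_count x Y = k.
Proof.
move=> nX; rewrite /star_index; case: eqP => [->|XS].
  by rewrite star_ext_special.
by rewrite star_ext_nonspecial.
Qed.

(** A vertex of rank [n.+1] is in [B n.+1], hence in [S n] but not in its extension [A n.+1]. *)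
Lemma live_ext n X : m <= n -> live n X -> live n.+1 (ext A n X).
Proof.
move=> mn [nX Xn]; split=> [|x ex]; first exact: ext_class.
have xn := Xn _ (ext_sub nX ex); rewrite ltn_neqAle xn andbT.
apply/eqP => /esym xn1; have Sx := rank_special hb xn1.
have XS := classes_disjoint nX (split_S hs n) (ext_sub nX ex) Sx.
rewrite XS star_ext_special in ex; apply: (split_AB hs ex).
by rewrite B_lev.
Qed.

(** The extension of [X] has ranks above [n.+1], and the rank drops by at most one along an edge. *)
Lemma live_step n X Y : m <= n -> live n X -> star_step phi S A n X Y -> live n Y.
Proof.
move=> mn lX [nY [k k0 /(star_indexE _ _ lX.1)[x ex xk]]]; split=> // y' Yy'.
have [_ /(_ _ ex) xn] := live_ext mn lX.
have [y Yy xy] : touches x Y by apply/nb_count_gt0; rewrite xk.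
rewrite ltnNge; apply/negP => yn'.
have := rank_le_equiv hs hb yn' (class_equiv nY Yy' Yy).
move=> /(equiv_all_rank hs hb) yy'; rewrite adjC in xy.
by have := rank_adj hs hb xy; rewrite -yy'; lia.
Qed.

Lemma live_reachable n X Y : m <= n -> live n X ->
  clos_refl_trans _ (star_step phi S A n) X Y -> live n Y.
Proof.
move=> mn lX XY; elim: XY lX => {X Y} [X Y XY lX|//|X Y Z _ IH1 _ IH2 lX].
  exact: live_step XY.
exact: IH2 (IH1 lX).
Qed.

Lemma star_index_ext n X Y k : m <= n -> live n X -> live n Y ->
  star_index S A n X Y k <->
  star_index S A n.+1 (ext A n X) (ext A n Y) k.
Proof.
move=> mn lX lY; have [nX _] := lX; have [nY _] := lY.
rewrite star_indexE // (star_indexE _ _ (ext_class nX)).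
have lX1 := live_ext mn lX; have lX2 := live_ext (leqW mn) lX1.
(* A vertex of rank above [n.+2] has no neighbor in [B n.+1], of rank [n.+1], so all its neighbors
   in [S n] are in [A n.+1]. *)
have eqY x : ext A n.+1 (ext A n X) x -> nb_count x (ext A n Y) = nb_count x Y.
  move=> exx; case: (pselect (Y = S n)) => [->|YS]; last first.
    by rewrite star_ext_nonspecial.
  rewrite star_ext_special; apply: eq_in_count => y xy; apply/idP/idP; rewrite !inE.
    exact: (@subAS _ _ _ _ _ _ _ hs n).
  move=> /(split_SAB hs)[//|]; rewrite B_lev // => yn.
  have := lX2.2 _ exx; have yx : adj y x by rewrite adjC.
  by have := rank_adj hs hb yx; rewrite (yn : rk y = n.+1); lia.
have sub := ext_sub (ext_class nX).
have [x0 ex0] := class_inh (ext_class (ext_class nX)).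
split=> [[x ex xk]|[x exx xk]]; last by exists x; [exact: sub|rewrite -eqY].
exists x0 => //; rewrite eqY // -xk.
have [u Yu] := class_inh nY; rewrite (bclasses_eq nY Yu).
exact: ball_equiv_count (class_equiv (ext_class nX) (sub _ ex0) ex).
Qed.

Lemma star_step_ext n X Y : m <= n -> live n X -> live n Y ->
  star_step phi S A n X Y <-> star_step phi S A n.+1 (ext A n X) (ext A n Y).
Proof.
move=> mn lX lY; split=> -[_ [k k0 XYk]].
  split; first exact: ext_class lY.1.
  by exists k => //; rewrite -star_index_ext.
split; first exact: lY.1.
by exists k => //; rewrite star_index_ext.
Qed.

Lemma ext_inj n X Y : bclasses phi n X -> bclasses phi n Y ->
  ext A n X = ext A n Y -> X = Y.
Proof.
move=> nX nY XY; have [x ex] := class_inh (ext_class nX).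
apply: (classes_disjoint nX nY (ext_sub nX ex)).
by apply: (ext_sub nY); rewrite -XY.
Qed.

(** The only class of [n.+1]-balls that is not an extension is [B n.+1], and it is not live. *)
Lemma ext_surj n Y : m <= n -> live n.+1 Y -> exists2 X, live n X & ext A n X = Y.
Proof.
move=> mn [nY Yn]; case: (pselect (Y = A n.+1)) => [->|YA].
  by exists (S n); [exact: live_special|rewrite star_ext_special].
have YB : Y <> B n.+1.
  move=> YB; have [y Yy] := class_inh nY; have := Yn y Yy.
  by move: Yy; rewrite YB B_lev // => ->; rewrite ltnn.
have [nY' YS] := class_down hs nY YA YB.
by exists Y; [split=> // y /Yn /ltnW|rewrite star_ext_nonspecial].
Qed.

Lemma reach_ext n X Y : m <= n -> live n X ->
  clos_refl_trans _ (star_step phi S A n) X Y ->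
  clos_refl_trans _ (star_step phi S A n.+1) (ext A n X) (ext A n Y).
Proof.
move=> mn lX XY; elim: XY lX => {X Y} [X Y XY lX|X lX|X Y Z XY IH1 _ IH2 lX].
- by apply: rt_step; apply/(star_step_ext mn lX (live_step mn lX XY)).
- exact: rt_refl.
- by apply: rt_trans (IH1 lX) (IH2 _); exact: live_reachable XY.
Qed.

Lemma reach_unext n X' Y' : m <= n -> live n.+1 X' ->
  clos_refl_trans _ (star_step phi S A n.+1) X' Y' ->
  forall X Y, live n X -> live n Y -> ext A n X = X' -> ext A n Y = Y' ->
  clos_refl_trans _ (star_step phi S A n) X Y.
Proof.
move=> mn lX XY; elim: XY lX => {X' Y'} [X' Y' XY lX|X' lX|X' Y' Z' XY IH1 _ IH2 lX].
- move=> X Y lX' lY' eX eY; apply: rt_step; apply/star_step_ext => //.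
  by rewrite eX eY.
- move=> X Y lX' lY' eX eY; rewrite (@ext_inj n X Y) //.
  + exact: rt_refl.
  + exact: lX'.1.
  + exact: lY'.1.
  + by rewrite eX.
- move=> X Z lX' lZ' eX eZ.
  have lY := live_reachable (leqW mn) lX XY.
  have [Y lY' eY] := ext_surj mn lY.
  by apply: rt_trans (IH1 lX X Y lX' lY' eX eY) (IH2 lY Y Z lY' lZ' eY eZ).
Qed.

Lemma star_step_SA n : star_step phi S A n.+1 (S n.+1) (A n.+1).
Proof.
split; first exact: (split_A hs).
have [x Ax] := class_inh (split_A hs n.+2); have tx := split_AA hs Ax.
exists (nb_count x (A n.+1)); first exact/nb_count_gt0.
by exists x; rewrite ?eqxx.
Qed.

(** The extension sends the starting vertex [S n] to [A n.+1], not to the starting vertex [S n.+1]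
    of the next graph; together with [star_step_SA], the same classes are reachable from both. *)
Lemma star_reach_AS n :
  clos_refl_trans _ (star_step phi S A n.+1) (A n.+1) (S n.+1).
Proof.
case: (pselect (A n.+1 = S n.+1)) => [->|AS]; first exact: rt_refl.
apply: rt_step; split; first exact: (split_S hs).
have [x Ax] := class_inh (split_A hs n.+2); have [y Ay xy] := split_AA hs Ax.
exists (nb_count y (S n.+1)).
  by apply/nb_count_gt0; exists x; [exact: (subAS hs Ax)|rewrite adjC].
by exists y => //; case: eqP.
Qed.

Lemma star_graph_iso_next n : m <= n ->
  eisomorphic (star_graph phi S A n) (star_graph phi S A n.+1).
Proof.
move=> mn; have lS := live_special.
have live_vert k X : m <= k -> vert (star_graph phi S A k) X -> live k X.
  by move=> mk; exact: live_reachable.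
exists (star_extension phi S A n); split; first split.
- move=> X VX; apply: rt_trans (reach_ext mn (lS n) VX).
  by rewrite star_ext_special; apply: rt_step; exact: star_step_SA.
- move=> X Y; rewrite !inE => /(live_vert _ _ mn)[nX _] /(live_vert _ _ mn)[nY _].
  exact: ext_inj.
- move=> Y VY; have lY := live_vert _ _ (leqW mn) VY.
  have [X lX eX] := ext_surj mn lY; exists X => //.
  apply: (@reach_unext n (A n.+1) Y mn _ _ (S n) X) => //.
  + by rewrite -(star_ext_special A); exact: live_ext.
  + by apply: rt_trans VY; exact: star_reach_AS.
  + exact: star_ext_special.
- by move=> X Y /(live_vert _ _ mn) lX /(live_vert _ _ mn) lY k; exact: star_index_ext.
Qed.

Lemma star_graph_iso n k : m <= n -> m <= k ->
  eisomorphic (star_graph phi S A n) (star_graph phi S A k).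
Proof.
wlog nk : n k / n <= k.
  move=> h mn mk; case: (leqP n k) => [nk|/ltnW kn]; first exact: h.
  by apply: eisomorphic_sym; exact: h.
move=> mn _; move/subnK: nk => <-; elim: (k - n) => [|j IH].
  exact: eisomorphic_refl.
apply: eisomorphic_trans IH (star_graph_iso_next _).
by rewrite (leq_trans mn) // leq_addl.
Qed.

Local Notation G := (star_graph phi S B).
Local Notation e := (star_extension phi S B).

Lemma level_nonspecial n k : m < n -> n <= k ->
  bclasses phi k (lev n) /\ lev n <> S k.
Proof.
move=> mn nk; have [x xn] := level_inh hs hb hl hd mn; split.
  by rewrite -xn (@level_class _ _ _ _ _ _ _ hs hb k) ?xn //; exists x.
move=> e; have : S k x by rewrite -e.
by move/(special_lt_rank hb); rewrite xn ltnNge nk.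
Qed.

Lemma push_level n N : m < n -> n <= N -> push e n N (lev n) = lev n.
Proof.
move=> mn /subnK <-; elim: (N - n) => [|k IH]; first exact: push_refl.
rewrite addSn pushS ?leq_addl // IH star_ext_nonspecial //.
  by apply: (level_nonspecial mn _).1; exact: leq_addl.
by apply: (level_nonspecial mn _).2; exact: leq_addl.
Qed.

Lemma level_vert n : m < n -> vert (G n) (lev n).
Proof.
move=> mn; rewrite -B_lev //; apply: rt_step; split; first exact: (split_B hs).
have [x Bx] := class_inh (split_B hs n.+1); have tx := split_BB hs Bx.
exists (nb_count x (B n)); first exact/nb_count_gt0.
by exists x; rewrite ?eqxx.
Qed.

(** A class that becomes special at some stage is sent to the next [B], which is a level; otherwise
    it is a level once the stage reaches the rank of one of its vertices. *)
Lemma push_eventually_level n U : m <= n -> bclasses phi n U ->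
  exists N t, [/\ n <= N, m < t, t <= N & push e n N U = lev t].
Proof.
move=> mn nU; have [u Uu] := class_inh nU.
have h k : bclasses phi (k + n) U /\ push e n (k + n) U = U \/
    exists2 t, m < t <= k + n & push e n (k + n) U = lev t.
  elim: k => [|k [[nkU pU]|[t /andP[mt tk] pt]]].
  - by left; rewrite add0n push_refl.
  - rewrite addSn pushS ?leq_addl // pU.
    case: (pselect (U = S (k + n))) => [->|US].
      right; exists (k + n).+1; first by lia.
      by rewrite star_ext_special B_lev //; lia.
    by left; rewrite star_ext_nonspecial //; split=> //; exact: (class_up hs nkU US).
  - right; exists t; first by lia.
    rewrite addSn pushS ?leq_addl // pt.
    by have [nt tS] := level_nonspecial mt tk; rewrite star_ext_nonspecial.
have [[nkU pU]|[t /andP[mt tk] pt]] := h (rk u); last first.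
  by exists (rk u + n), t; split=> //; exact: leq_addl.
exists (rk u + n), (rk u); split=> //; [exact: leq_addl|exact: leq_addr|].
rewrite pU (bclasses_eq nkU Uu) (@level_class _ _ _ _ _ _ _ hs hb (rk u + n)) //.
exact: leq_addr.
Qed.

Lemma germ_level t p : m < t -> germ G e m (t, lev t) p ->
  exists N, forall n, N <= n -> t <= n /\ push e p.1 n p.2 = lev t.
Proof.
move=> mt [_ _ [N /= [tN pN tp]]]; exists N => n Nn.
split; first exact: leq_trans Nn.
by rewrite (push_trans _ _ pN Nn) -tp -(push_trans _ _ tN Nn) push_level // (leq_trans tN).
Qed.

Lemma quotient_iso_limit : eisomorphic (quotient_graph phi) (star_limit phi S B m).
Proof.
have [x0 _] := tree_inhabited T.
(* The stage attached to [lev n] is [n] itself, recovered as the rank of a chosen vertex. *)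
pose f X := germ G e m (rk (xget x0 X), X).
have fE n : m < n -> f (lev n) = germ G e m (n, lev n).
  move=> mn; rewrite /f; have [x xn] := level_inh hs hb hl hd mn.
  by have -> : rk (xget x0 (lev n)) = n by exact: (@xgetI _ x0 (lev n) x).
have self n : m < n -> germ G e m (n, lev n) (n, lev n).
  by move=> mn; apply: germ_self; [exact: ltnW|exact: level_vert].
have orbP X : range (Defs.orbit phi) X <-> exists2 n, m < n & X = lev n.
  exact: (orbitP hs hb hl hd hm).
exists f; split; first split.
- move=> X /orbP[n mn ->]; exists (n, lev n); rewrite fE //; split=> //=.
    exact: ltnW.
  exact: level_vert.
- move=> X Y; rewrite !inE => /orbP[n mn ->] /orbP[n' mn' ->].
  rewrite !fE // => ff; have := self n mn; rewrite ff => /(germ_level mn')[N hN].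
  have [_ /= h] := hN (maxn n N) (leq_maxr _ _).
  by rewrite -h push_level // leq_maxl.
- move=> X [[n U] /= [mn VU ->]].
  have nU : bclasses phi n U.
    have : bclasses phi n (S n) by exact: (split_S hs).
    by elim: VU => {U} [Y Z []//|//|Y Y' Z _ IH _ IH' /IH/IH'].
  have [N [t [nN mt tN pN]]] := push_eventually_level mn nU.
  exists (lev t); first by apply/orbP; exists t.
  rewrite fE //; apply: (@eq_germ _ _ _ _ _ _ N) => //=.
  by rewrite pN push_level.
(* At stages from [t] on, [lev t] is not special, so the index of the star graph is counted from its
   own vertices, as in the quotient. *)
move=> X Y /orbP[t mt ->] /orbP[t' mt' ->] k; rewrite !fE //; split.
- move=> [x xt xk]; exists (t, lev t), (t', lev t'); split; try exact: self.
  exists (maxn t t') => n; rewrite geq_max => /andP[tn tn'].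
  rewrite /= !push_level //; exists x => //.
  by case: eqP => // tS; have [_] := level_nonspecial mt tn.
- move=> [p [q [/(germ_level mt)[N hN] /(germ_level mt')[N' hN'] [M hM]]]].
  pose n := maxn M (maxn N N').
  have nM : M <= n by exact: leq_maxl.
  have nN : N <= n by rewrite leq_max leq_maxl orbT.
  have nN' : N' <= n by rewrite leq_max leq_maxr orbT.
  have [tn pn] := hN n nN; have [_ qn] := hN' n nN'.
  have [x] := hM n nM; rewrite pn qn; case: eqP => [tS|_ xt xk].
    by have [_] := level_nonspecial mt tn.
  by exists x.
Qed.

End Star.

(** * Bounded type, the limit of star graphs and the special balls along the ray *)

Theorem proposition5p4 (d : nat) (T : regular_tree d) (phi : T -> bool)
    (a : bool) (S A B C : nat -> set T)
    (hphi : sturmian phi)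
    (hname : special_naming phi a S A B C)
    (hcycle : exists n c, ball_cycle phi n c) :
  bounded_type phi S /\
  exists m : nat,
    (S_C_on_cycle phi S C m /\
     forall k, S_C_on_cycle phi S C k -> (m <= k)%N) /\
    (((forall n k, (m <= n)%N -> (m <= k)%N ->
         eisomorphic (star_graph phi S A n) (star_graph phi S A k)) /\
      eisomorphic (quotient_graph phi) (star_limit phi S B m))
     \/
     ((forall n k, (m <= n)%N -> (m <= k)%N ->
         eisomorphic (star_graph phi S B n) (star_graph phi S B k)) /\
      eisomorphic (quotient_graph phi) (star_limit phi S A m))) /\
    ((exists x : nat -> set T, ray_enumeration (quotient_graph phi) x) /\
     forall x : nat -> set T, ray_enumeration (quotient_graph phi) x ->
       forall (i : nat) (v : T), x i v -> bclass phi (m + i)%N v = S (m + i)%N).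
Proof.
have hs := naming_splitting hphi hname; have hs' := splitting_sym hs.
have hl := sturmian_linear hs.
(* A detached class consists of settled vertices; a single one makes all ranks finite. *)
have settledE P Q k : splitting phi S P Q C -> detached phi S Q k setT ->
    exists x, settled S k x.
  move=> hPQ hd; have [x Qx] := class_inh (split_B hPQ k).
  by exists x; exact: (detached_settled hl hPQ hd Qx).
have [n [c hc]] := hcycle; have [k hk] := cycle_detached hl hs hc.
have hb : forall x, exists t, settled S t x.
  suff [x kx] : exists x, settled S k x by exact: (settled_all hs kx).
  by case: hk => hd; [exact: settledE hs hd|exact: settledE hs' hd].
have exSC : exists m, `[< S_C_on_cycle phi S C m >].
  by exists k; apply/asboolP; case: hk => hd;
    [exact: (detached_S_C hl hs hd)|exact: (detached_S_C hl hs' hd)].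
have [m /asboolP mSC mmin] := ex_minnP exSC.
have {}mmin j : S_C_on_cycle phi S C j -> m <= j.
  by move=> jSC; apply: mmin; apply/asboolP.
have hm := rank_min hs hb hl mSC mmin.
split.
  move=> v; apply: (@sub_finite_set _ _ `I_(rank S v)); last exact: finite_II.
  move=> j /= jS; apply: (special_lt_rank hb); rewrite -jS; exact: bclass_self.
exists m; split=> //.
have [ray uray] : (exists x, ray_enumeration (quotient_graph phi) x) /\
    forall x, ray_enumeration (quotient_graph phi) x ->
      forall i, x i = level S (m.+1 + i).
  case: (S_C_detached hl hs mSC) => hd.
    split; first by exists (fun i => level S (m.+1 + i));
      exact: (quotient_ray hs hb hl hd hm).
    by move=> x; exact: (quotient_ray_unique hs hb hl hd hm).
  split; first by exists (fun i => level S (m.+1 + i));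
    exact: (quotient_ray hs' hb hl hd hm).
  by move=> x; exact: (quotient_ray_unique hs' hb hl hd hm).
split; last first.
  (* The vertices of [x i] have rank [m.+1 + i], one more than the last level at which they are
     special. *)
  split=> // x /uray xE i v; rewrite xE => vi; apply/esym.
  by apply: (bclasses_eq (split_S hs _)); apply: (rank_special hb); rewrite vi addSn.
(* The detached letter gives the limit; the star graphs of the other letter are all isomorphic. *)
case: (S_C_detached hl hs mSC) => hd; [left|right]; split.
- by move=> i j; exact: (star_graph_iso hs hb hl hd).
- exact: (quotient_iso_limit hs hb hl hd hm).
- by move=> i j; exact: (star_graph_iso hs' hb hl hd).
- exact: (quotient_iso_limit hs' hb hl hd hm).
Qed.
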